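(* Let $(\mathcal A_\gamma)_{\gamma\in\Gamma}$ be a family of random variables with values in $\mathcal K_+(\Pi_{\rm c})$. Then the laws $(\mu_\gamma)_{\gamma\in\Gamma}$ with $\mu_\gamma:=\mathbb P[\mathcal A_\gamma\in\,\cdot\,]$ are tight with respect to the topology on $\Pi_{\rm c}$ (that is, tight as probability measures on $\mathcal K_+(\Pi_{\rm c})$) if and only if $$\lim_{\delta\to 0}\ \sup_{\gamma\in\Gamma}\ \mathbb P\big[\mathcal S^2_{T,\delta,\varepsilon,r}\cap\mathcal A_\gamma\neq\emptyset\big]=0\qquad\text{for all }T,\varepsilon>0,\ r\in\mathbb R.$$
   Context: Let $\overline{\mathbb R}:=[-\infty,\infty]$, and for $x,z\in\overline{\mathbb R}$ write $[x,z]:=\{y\in\overline{\mathbb R}:x\wedge z\le y\le x\vee z\}$. Squeezed space: $\mathbb R^2_{\rm c}:=(\overline{\mathbb R}\times\mathbb R)\cup\{(\ast,-\infty),(\ast,+\infty)\}$, equipped with the unique metrisable topology that makes it compact and such that $(x_n,t_n)\to(x,t)$ iff $t_n\to t$ in $\overline{\mathbb R}$ and, if $t\in\mathbb R$, also $x_n\to x$ in $\overline{\mathbb R}$. Let $d_{\rm sqz}$ be any metric generating this topology. Paths: let $\hat I\subset\overline{\mathbb R}$ be nonempty and closed, $I:=\hat I\cap\mathbb R$, and let $I^-$ (resp. $I^+$) be the set of $t\in I$ such that $(t-\varepsilon,t)\cap I\ne\emptyset$ (resp. $(t,t+\varepsilon)\cap I\neq\emptyset$) for all $\varepsilon>0$.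 A path is a triple $(\hat I,\pi^-,\pi^+)$ where $\pi^\pm:I\to\overline{\mathbb R}$, $\pi^-$ is left-continuous, $\pi^+$ is right-continuous, $\pi^-(t)=\lim_{s\uparrow t}\pi^+(s)$ for $t\in I^-$ and $\pi^+(t)=\lim_{s\downarrow t}\pi^-(s)$ for $t\in I^+$ (limits over $s\in I$). Write $\pi(t\pm):=\pi^\pm(t)$, and $I_\pi:=I$, $\hat I_\pi:=\hat I$ for the domain and extended domain. A path is identified with its closed graph $\pi:=\{(x,t):t\in I,\ x\in\{\pi(t-),\pi(t+)\}\}\cup\{(\ast,t):t\in\hat I\setminus I\}\subset\mathbb R^2_{\rm c}$, totally ordered by $\preceq$, where $(x,s)\prec(y,t)$ iff $s<t$, or $s=t\in\mathbb R$ and $x$ lies closer to $\pi(t-)$ than $y$. $\Pi$ is the set of all paths. Topology: a correspondence between sets $A,B$ is a set $C\subset A\times B$ such that every $a\in A$ and every $b\in B$ occurs in some pair in $C$. A correspondence $C$ between $\pi_1,\pi_2$ is monotone if there are no $(z_1,z_2),(z_1',z_2')\in C$ with $z_1\prec z_1'$ and $z_2'\prec z_2$. The J1 topology on $\Pi$ is generated by the metric $d_{\rm J1}(\pi_1,\pi_2):=\inf_C\sup_{(z_1,z_2)\in C}d_{\rm sqz}(z_1,z_2)$, the infimum being over monotone correspondences $C$ between $\pi_1$ and $\pi_2$ (the topology does not depend on the choice of $d_{\rm sqz}$). $\Pi_{\rm c}:=\{\pi\in\Pi:\pi(t-)=\pi(t+)\ \forall t\in I_\pi\}$ is the subspace of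 continuous paths, with the induced topology (the M1 topology induces the same topology on $\Pi_{\rm c}$). For a metrisable space $\mathcal X$, $\mathcal K_+(\mathcal X)$ is the space of nonempty compact subsets of $\mathcal X$ with the Hausdorff topology. A family $(\mu_\gamma)_{\gamma\in\Gamma}$ of probability measures on $\mathcal K_+(\mathcal X)$ is tight if for every $\varepsilon>0$ there is a compact $\mathcal C\subset\mathcal K_+(\mathcal X)$ with $\sup_\gamma\mu_\gamma(\mathcal K_+(\mathcal X)\setminus\mathcal C)\le\varepsilon$. For $\pi\in\Pi$ and $T,\delta>0$ let $\Delta^2_{T,\delta}(\pi):=\{(x,y)\in\overline{\mathbb R}^2:\exists\,-T\le s\le t\le T\text{ with }t-s\le\delta,\ (x,s),(y,t)\in\pi,\ (x,s)\preceq(y,t)\}$. For $T,\delta,\varepsilon>0$, $r\in\mathbb R$ let $\mathcal S^+_{T,\delta,\varepsilon,r}:=\{\pi\in\Pi:\exists(x,y)\in\Delta^2_{T,\delta}(\pi)\text{ with }x\le r,\ r+\varepsilon\le y\}$, $\mathcal S^-_{T,\delta,\varepsilon,r}:=\{\pi\in\Pi:\exists(x,y)\in\Delta^2_{T,\delta}(\pi)\text{ with }y\le r,\ r+\varepsilon\le x\}$, and $\mathcal S^2_{T,\delta,\varepsilon,r}:=\mathcal S^+_{T,\delta,\varepsilon,r}\cup\mathcal S^-_{T,\delta,\varepsilon,r}$. *)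

(* Defs.v *)
From HB Require Import structures.
From mathcomp Require Import all_boot all_order all_algebra.
From mathcomp Require Import all_classical all_reals all_analysis.

Set Implicit Arguments.
Unset Strict Implicit.
Unset Printing Implicit Defensive.

Import Order.TTheory GRing.Theory Num.Theory.
Import numFieldNormedType.Exports.

Local Open Scope classical_set_scope.
Local Open Scope ring_scope.

Definition dist_open (R : realType) (T : Type) (D : T -> T -> \bar R) :
    set (set T) :=
  [set U | forall x, U x ->
     exists2 e : R, 0 < e & forall y, (D x y < e%:E)%E -> U y].

Section dist_open_topology.
Context (R : realType) (T : Type) (D : T -> T -> \bar R).

Lemma dist_openT : dist_open D setT.
Proof. by move=> x _; exists 1. Qed.

Lemma dist_openI : setI_closed (dist_open D).
Proof.
move=> U V oU oV x [/oU[e e0 eU] /oV[f f0 fV]].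
exists (Num.min e f); first by rewrite lt_min e0.
by move=> y; rewrite EFin_min lt_min => /andP[/eU Uy /fV Vy].
Qed.

Lemma dist_open_bigU (I : Type) (f : I -> set T) :
  (forall i, dist_open D (f i)) -> dist_open D (\bigcup_i f i).
Proof.
move=> of_ x [i _ /of_[e e0 ef]]; exists e => // y /ef fiy.
by exists i.
Qed.

End dist_open_topology.

(* The squeezed space.  [SqzPt x t] is the point (x, t) with t real; [SqzNinfty]
   and [SqzPinfty] are the points ( *, -oo) and ( *, +oo). *)
Inductive sqz (R : realType) : Type :=
  | SqzPt of \bar R & R
  | SqzNinfty
  | SqzPinfty.
Arguments SqzNinfty {R}.
Arguments SqzPinfty {R}.

Definition sqz_time (R : realType) (z : sqz R) : \bar R :=
  match z with
  | SqzPt _ t => t%:E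
  | SqzNinfty => -oo%E
  | SqzPinfty => +oo%E
  end.

(* The value 0 at the two points at infinity is never used: it only matters for
   finitely many terms of a sequence whose times converge to a real number. *)
Definition sqz_space (R : realType) (z : sqz R) : \bar R :=
  if z is SqzPt x _ then x else 0%E.

Definition sqz_cvg (R : realType) (u : nat -> sqz R) (z : sqz R) : Prop :=
  (sqz_time (u n) @[n --> \oo] --> sqz_time z) /\
  (forall x t, z = SqzPt x t -> sqz_space (u n) @[n --> \oo] --> x).

(* Any metric that generates the topology of the squeezed space.  A metrisable
   topology is determined by its convergent sequences; compactness of the
   squeezed space follows from [sqz_distP] and the compactness of \bar R. *)
Record sqz_metric (R : realType) := SqzMetric {
  sqz_dist :> sqz R -> sqz R -> R;
  sqz_dist_eq0 : forall z w, sqz_dist z w = 0 <-> z = w;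
  sqz_dist_sym : forall z w, sqz_dist z w = sqz_dist w z;
  sqz_dist_triangle : forall z w v,
    sqz_dist z v <= sqz_dist z w + sqz_dist w v;
  sqz_distP : forall (u : nat -> sqz R) (z : sqz R),
    (sqz_dist (u n) z @[n --> \oo] --> (0 : R)) <-> sqz_cvg u z
}.

Section sqz_metric_exists.
Context (R : realType).
Implicit Types (z w v : sqz R) (t : R) (x : \bar R).

Let tc z : R := contract (sqz_time z).
Let sc z : R := contract (sqz_space z).
Let ht z : R := 1 - `|tc z|.
Let dist z w : R := `|tc z - tc w| + `|sc z * ht z - sc w * ht w|.

Let cvg_contract (u : nat -> \bar R) x :
  u @ \oo --> x <-> contract (u n) @[n --> \oo] --> contract x.
Proof.
split => [/cvg_ballP ux|/cvgrPdist_lt ux].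
  by apply/cvgrPdist_lt => e e0; exact: ux.
by apply/cvg_ballP => e e0; exact: ux.
Qed.

Let ht_Pt x t : 0 < ht (SqzPt x t).
Proof. by rewrite subr_gt0 contract_lt1. Qed.

Let ht_ge0 z : 0 <= ht z.
Proof. by rewrite subr_ge0 contract_le1. Qed.

Let sc_ht z : sc z = sc z * ht z * (ht z)^-1.
Proof.
case: z => [x t||]; first by rewrite mulfK// gt_eqF.
all: by rewrite (_ : sc _ = 0) ?mul0r//; exact: contract0.
Qed.

Let dist_eq0 z w : dist z w = 0 <-> z = w.
Proof.
split=> [/eqP|->]; last by rewrite /dist !subrr normr0 addr0.
rewrite paddr_eq0// !normr_eq0 !subr_eq0 => /andP[/eqP tzw /eqP szw].
have hzw : ht z = ht w by rewrite /ht tzw.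
have szw' : sc z = sc w by rewrite (sc_ht z) szw hzw -sc_ht.
move: tzw szw' => /contract_inj + /contract_inj.
by case: z {hzw szw} => [x t||]; case: w => [y s||] //= [->] ->.
Qed.

Let dist_sym z w : dist z w = dist w z.
Proof. by rewrite /dist distrC (distrC (sc z * _)). Qed.

Let dist_triangle z w v : dist z v <= dist z w + dist w v.
Proof.
rewrite /dist addrACA lerD//.
  by rewrite (le_trans _ (ler_normD _ _))// addrA subrK.
by rewrite (le_trans _ (ler_normD _ _))// addrA subrK.
Qed.

Let distP (u : nat -> sqz R) z :
  (dist (u n) z @[n --> \oo] --> (0 : R)) <-> sqz_cvg u z.
Proof.
have cvg_dist (f : nat -> R) (a : R) :
    f @ \oo --> a <-> `|f n - a| @[n --> \oo] --> (0 : R).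
  split=> [fa|fa].
    rewrite -(normr0 R) -(subrr a).
    by apply: cvg_norm; apply: cvgB => //; exact: cvg_cst.
  by apply/subr_cvg0; apply/norm_cvg0P.
have hcvg : tc (u n) @[n --> \oo] --> tc z ->
    ht (u n) @[n --> \oo] --> ht z.
  by move=> tu; apply: cvgB; [exact: cvg_cst|exact: cvg_norm].
split=> [du|[tu su]].
  have tu : tc (u n) @[n --> \oo] --> tc z.
    apply/cvg_dist; apply: squeeze_cvgr du; last exact: cvg_cst.
    by apply: nearW => n; rewrite normr_ge0 lerDl normr_ge0.
  have su : sc (u n) * ht (u n) @[n --> \oo] --> sc z * ht z.
    apply/(cvg_dist (fun n => sc (u n) * ht (u n))).
    apply: squeeze_cvgr du; last exact: cvg_cst.
    by apply: nearW => n; rewrite normr_ge0 lerDr normr_ge0.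
  split=> [|x t zE]; first exact/cvg_contract.
  have hz : ht z != 0 by rewrite zE gt_eqF.
  suff : sc (u n) @[n --> \oo] --> sc z by rewrite zE; move/cvg_contract.
  rewrite (sc_ht z) (_ : (fun n => sc (u n)) =
    (fun n => sc (u n) * ht (u n) * (ht (u n))^-1)); last first.
    by apply/funext => n; exact: sc_ht.
  by apply: cvgM; [exact: su|apply: (cvgV hz); exact: hcvg].
have {}tu : tc (u n) @[n --> \oo] --> tc z by exact/cvg_contract.
have hu := hcvg tu.
rewrite -(addr0 0); apply: cvgD; first exact/(cvg_dist (fun n => tc (u n))).
apply/(cvg_dist (fun n => sc (u n) * ht (u n))).
case: z su tu {hcvg} hu => [x t||] su tu hu.
- apply: cvgM; last exact: hu.
  apply/(cvg_contract (fun n => sqz_space (u n))).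
  exact: (su _ _ erefl).
- have h0 : ht (SqzNinfty : sqz R) = 0 by rewrite /ht /tc /= normrN1 subrr.
  rewrite h0 mulr0; apply/norm_cvg0P.
  apply: (@squeeze_cvgr _ _ _ _ (cst 0) (fun n => ht (u n))).
  + apply: nearW => n; rewrite normr_ge0/= normrM (ger0_norm (ht_ge0 _)).
    by rewrite ler_piMl// contract_le1.
  + exact: cvg_cst.
  + by rewrite -h0.
- have h0 : ht (SqzPinfty : sqz R) = 0 by rewrite /ht /tc /= normr1 subrr.
  rewrite h0 mulr0; apply/norm_cvg0P.
  apply: (@squeeze_cvgr _ _ _ _ (cst 0) (fun n => ht (u n))).
  + apply: nearW => n; rewrite normr_ge0/= normrM (ger0_norm (ht_ge0 _)).
    by rewrite ler_piMl// contract_le1.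
  + exact: cvg_cst.
  + by rewrite -h0.
Qed.

Lemma sqz_metric_inhabited : inhabited (sqz_metric R).
Proof. by split; exact: SqzMetric dist_eq0 dist_sym dist_triangle distP. Qed.

End sqz_metric_exists.

Definition real_times (R : realType) (I : set (\bar R)) : set R :=
  [set t | I t%:E].

Definition left_acc (R : realType) (I : set R) : set R :=
  [set t | I t /\ forall e, 0 < e -> (`]t - e, t[%classic `&` I) !=set0].

Definition right_acc (R : realType) (I : set R) : set R :=
  [set t | I t /\ forall e, 0 < e -> (`]t, t + e[%classic `&` I) !=set0].

(* [edom], [lval] and [rval] are the extended domain and the functions pi^- and
   pi^+.  The latter two are extended by 0 outside the domain, so that equality
   of paths is equality of triples.  One-sided continuity at t is convergence
   along [within I t^'-] or [within I t^'+]; it holds trivially when t is not a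
   limit of points of I from that side. *)
Record jpath (R : realType) := JPath {
  edom : set (\bar R);
  lval : R -> \bar R;
  rval : R -> \bar R;
  edom_nonempty : edom !=set0;
  edom_closed : closed edom;
  lval_continuous : forall t, real_times edom t ->
    lval s @[s --> within (real_times edom) t^'-] --> lval t;
  rval_continuous : forall t, real_times edom t ->
    rval s @[s --> within (real_times edom) t^'+] --> rval t;
  lval_lim : forall t, left_acc (real_times edom) t ->
    rval s @[s --> within (real_times edom) t^'-] --> lval t;
  rval_lim : forall t, right_acc (real_times edom) t ->
    lval s @[s --> within (real_times edom) t^'+] --> rval t;
  lval_out : forall t, ~ real_times edom t -> lval t = 0%E;
  rval_out : forall t, ~ real_times edom t -> rval t = 0%E
}.

Definition dom (R : realType) (p : jpath R) : set R := real_times (edom p).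

Definition closed_graph (R : realType) (p : jpath R) : set (sqz R) :=
  [set z | match z with
           | SqzPt x t => dom p t /\ (x = lval p t \/ x = rval p t)
           | SqzNinfty => edom p -oo%E
           | SqzPinfty => edom p +oo%E
           end].

Definition segment (R : realType) (x z : \bar R) : set (\bar R) :=
  [set y | (Order.min x z <= y <= Order.max x z)%E].

(* [x] lies (strictly) closer to [a] than [y]; only used for x and y on the
   segment between the left and right values of a path, of which [a] is the
   left one. *)
Definition closer (R : realType) (a x y : \bar R) : Prop :=
  x <> y /\ segment a y x.

Definition path_lt (R : realType) (p : jpath R) (z w : sqz R) : Prop :=
  (sqz_time z < sqz_time w)%E \/
  exists t x y, [/\ z = SqzPt x t, w = SqzPt y t & closer (lval p t) x y].

Definition path_le (R : realType) (p : jpath R) (z w : sqz R) : Prop :=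
  path_lt p z w \/ z = w.

Definition correspondence (U V : Type) (A : set U) (B : set V)
    (C : set (U * V)) : Prop :=
  [/\ C `<=` A `*` B,
      forall a, A a -> exists b, C (a, b) &
      forall b, B b -> exists a, C (a, b)].

Definition monotone_corr (R : realType) (p1 p2 : jpath R)
    (C : set (sqz R * sqz R)) : Prop :=
  correspondence (closed_graph p1) (closed_graph p2) C /\
  ~ (exists z1 z2 z1' z2', [/\ C (z1, z2), C (z1', z2'),
       path_lt p1 z1 z1' & path_lt p2 z2' z2]).

Definition dJ1 (R : realType) (d : sqz_metric R) (p1 p2 : jpath R) : \bar R :=
  ereal_inf [set ereal_sup [set (d z.1 z.2)%:E | z in C] |
             C in monotone_corr p1 p2].

Definition pathJ1 (R : realType) (d : sqz_metric R) : Type := jpath R.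

HB.instance Definition _ (R : realType) (d : sqz_metric R) :=
  gen_eqMixin (pathJ1 d).
HB.instance Definition _ (R : realType) (d : sqz_metric R) :=
  gen_choiceMixin (pathJ1 d).
HB.instance Definition _ (R : realType) (d : sqz_metric R) :=
  isOpenTopological.Build (pathJ1 d) (@dist_openT R (pathJ1 d) (dJ1 d))
    (@dist_openI R (pathJ1 d) (dJ1 d)) (@dist_open_bigU R (pathJ1 d) (dJ1 d)).

Definition is_continuous_path (R : realType) (d : sqz_metric R) :
    set (pathJ1 d) :=
  [set p | forall t, dom p t -> lval p t = rval p t].

Definition cpath (R : realType) (d : sqz_metric R) : Type :=
  set_type (@is_continuous_path R d).

HB.instance Definition _ (R : realType) (d : sqz_metric R) :=
  Topological.on (cpath d).

Section cpath_pointed.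
Context (R : realType) (d : sqz_metric R).

(* The library's measurable spaces are pointed; the point chosen here is the
   path with extended domain {-oo}. *)
Let notin_Ninfty (t : R) : ~ real_times [set -oo%E] t.
Proof. by []. Qed.

Definition trivial_path : jpath R.
Proof.
apply: (@JPath R [set -oo%E] (cst 0%E) (cst 0%E)) => //.
- by exists -oo%E.
- exact: compact_closed (@ereal_hausdorff R) (@compact_set1 _ _).
- by move=> t [/notin_Ninfty].
- by move=> t [/notin_Ninfty].
Defined.

Lemma trivial_path_continuous : (trivial_path : pathJ1 d) \in @is_continuous_path R d.
Proof. by apply/mem_set => t /notin_Ninfty. Qed.

HB.instance Definition _ := isPointed.Build (cpath d)
  (exist _ (trivial_path : pathJ1 d) trivial_path_continuous).

End cpath_pointed.

Definition cdJ1 (R : realType) (d : sqz_metric R) (p q : cpath d) : \bar R :=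
  dJ1 d (val p) (val q).

(* K_+(X); the metric [D] of X determines the Hausdorff metric. *)
Record Kplus (R : realType) (X : topologicalType) (D : X -> X -> \bar R) :=
  KPlus {
    kset :> set X;
    kset_nonempty : kset !=set0;
    kset_compact : compact kset
  }.

Definition hausdorff_dist (R : realType) (X : Type) (D : X -> X -> \bar R)
    (A B : set X) : \bar R :=
  Order.max
    (ereal_sup [set ereal_inf [set D a b | b in B] | a in A])
    (ereal_sup [set ereal_inf [set D a b | a in A] | b in B]).

Section Kplus_topology.
Context (R : realType) (X : topologicalType) (D : X -> X -> \bar R).

Let dH (A B : Kplus D) : \bar R := hausdorff_dist D A B.

HB.instance Definition _ := gen_eqMixin (Kplus D).
HB.instance Definition _ := gen_choiceMixin (Kplus D).
HB.instance Definition _ := isOpenTopological.Build (Kplus D)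
  (@dist_openT R (Kplus D) dH) (@dist_openI R (Kplus D) dH)
  (@dist_open_bigU R (Kplus D) dH).

End Kplus_topology.

HB.instance Definition _ (R : realType) (X : ptopologicalType)
    (D : X -> X -> \bar R) :=
  isPointed.Build (Kplus D)
    (@KPlus R X D [set point] (ex_intro _ point erefl) (@compact_set1 X point)).

Notation borel X := (g_sigma_algebraType (@open X)).

Definition tight (R : realType) (X : ptopologicalType) (Gamma : Type)
    (mu : Gamma -> probability (borel X) R) : Prop :=
  forall eps : R, 0 < eps -> exists C : set X, compact C /\
    (ereal_sup (range (fun g => mu g (~` C))) <= eps%:E)%E.

Definition Delta2 (R : realType) (T delta : R) (p : jpath R) :
    set (\bar R * \bar R) :=
  [set xy | exists s t,
     [/\ - T <= s, s <= t, t <= T & t - s <= delta] /\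
     [/\ closed_graph p (SqzPt xy.1 s), closed_graph p (SqzPt xy.2 t) &
         path_le p (SqzPt xy.1 s) (SqzPt xy.2 t)]].

Definition Splus (R : realType) (T delta eps r : R) : set (jpath R) :=
  [set p | exists x y,
     [/\ Delta2 T delta p (x, y), (x <= r%:E)%E & ((r + eps)%:E <= y)%E]].

Definition Sminus (R : realType) (T delta eps r : R) : set (jpath R) :=
  [set p | exists x y,
     [/\ Delta2 T delta p (x, y), (y <= r%:E)%E & ((r + eps)%:E <= x)%E]].

Definition S2 (R : realType) (T delta eps r : R) : set (jpath R) :=
  Splus T delta eps r `|` Sminus T delta eps r.

(* Main.v *)
Require Import Defs.
From HB Require Import structures.
From mathcomp Require Import all_boot all_order all_algebra.
From mathcomp Require Import all_classical all_reals all_analysis.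
From mathcomp Require Import ring lra.

(** The proof is an Arzela-Ascoli argument carried out for graphs.

    A continuous path has exactly one graph point above each time of its
    extended domain, so its graph is a compact subset of the squeezed space,
    and the path is recovered from it ([cgraph_injective]).  For such paths the
    J1 distance and the Hausdorff distance of graphs have the same small balls:
    the former dominates the latter ([dJ1_hclose]), and conversely, matching
    every time of one path with the nearest times of the other is a monotone
    correspondence, whose distortion is controlled by the modulus of continuity
    of a fixed path in the neighbourhood ([hclose_cdJ1]).  Hence neighbourhoods
    in the space of continuous paths can be described by Hausdorff closeness of
    graphs alone ([nbhs_cpathP]).

    A continuous path belongs to the set S2 with parameters T, delta, eps, r
    exactly when its graph contains two points at times in [-T, T] that are
    at most delta apart, one with value at most r and the other with value at
    least r + eps; such pairs of points form the closed set [osc].  Two facts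
    about these pairs drive the theorem.

    First, being closed and without points on a single vertical line, they are
    avoided by every continuous path once delta is small, locally uniformly in
    the path ([osc_small]).  By compactness this is uniform over a compact
    family of compact sets of paths ([compact_nonoscillating]), so tightness
    makes the probabilities in the theorem small.

    Second, the Hausdorff limit G of the graphs along an ultrafilter of paths
    is again the graph of a continuous path as soon as G has at most one point
    above each real time ([path_of_graph]).  If all the paths avoid [osc] for
    every rational level r and every eps = 1 / (k + 1), with some delta for
    each, then G cannot have two such points (x, t) and (y, t), because a
    rational level with a gap of size eps fits between x and y.  Hence these
    paths form a relatively compact set ([compact_avoid]), and so do the
    nonempty compact sets of them ([compact_Kplus_sub]).  If the probabilities
    in the theorem tend to 0, delta can be chosen for the n-th choice of the
    parameters so that the exceptional probability is at most
    eps / 2 ^ (n + 1); summing over n gives tightness.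

    Two points of measure theory enter: the event that a random compact set
    meets S2 is Borel, as the complement of an open set of the hyperspace, and
    compact sets of the hyperspace are Borel because it is Hausdorff. *)

Set Implicit Arguments.
Unset Strict Implicit.
Unset Printing Implicit Defensive.

Import Order.TTheory GRing.Theory Num.Theory.
Import numFieldNormedType.Exports.
Local Open Scope classical_set_scope.
Local Open Scope ring_scope.

(** * The squeezed space as a metric space *)

(** A copy of the squeezed space for each metric, so that the metric can be
    found from the type. *)
Definition sqzS (R : realType) (d : sqz_metric R) : Type := sqz R.

HB.instance Definition _ (R : realType) (d : sqz_metric R) :=
  gen_eqMixin (sqzS d).
HB.instance Definition _ (R : realType) (d : sqz_metric R) :=
  gen_choiceMixin (sqzS d).

Lemma sqz_distxx (R : realType) (d : sqz_metric R) z : d z z = 0.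
Proof. exact/sqz_dist_eq0. Qed.

HB.instance Definition _ (R : realType) (d : sqz_metric R) :=
  @isMetric.Build R (sqzS d) d (@sqz_distxx R d)
    (fun z w => proj1 (@sqz_dist_eq0 R d z w)) (@sqz_dist_sym R d)
    (fun w z v => @sqz_dist_triangle R d z w v).

Section squeezed_space.
Context (R : realType) (d : sqz_metric R).
Implicit Types (z w : sqzS d) (x : \bar R) (t e : R).

Lemma sqz_ballE z e w : ball z e w = (d z w < e).
Proof. by []. Qed.

Lemma sqz_dist_ge0 z w : 0 <= d z w.
Proof. exact: (@mdist_ge0 R (sqzS d) z w). Qed.

(** Metric spaces are first countable, so the sequential description of the
    topology given with the metric suffices for continuity along filters. *)
Let sqz_seq_cvg (f : sqzS d -> \bar R) z x :
  (forall u : nat -> sqz R, sqz_cvg u z -> f (u n) @[n --> \oo] --> x) ->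
  f w @[w --> z] --> x.
Proof.
move=> fz; apply/(@cvg_ballP _ _ _ (nbhs z) _ f x) => e e0.
apply: contrapT => nfz.
have H n : exists w, ball z n.+1%:R^-1 w /\ ~ ball x e (f w).
  apply: contrapT => /forallNP H; apply: nfz.
  apply/nbhs_ballP; exists n.+1%:R^-1; first by rewrite /= invr_gt0.
  by move=> w zw; apply: contrapT => nw; apply: (H w).
have [u uP] := choice H.
have uz : sqz_cvg u z.
  apply/(sqz_distP d)/cvgrPdist_lt => r r0.
  near=> n.
  rewrite sub0r normrN ger0_norm ?sqz_dist_ge0// sqz_dist_sym.
  have [+ _] := uP n; rewrite sqz_ballE => /lt_trans; apply.
  by near: n; exact: (near_infty_natSinv_lt (PosNum r0)).
have := fz _ uz => /cvg_ballP /(_ e e0) [n _ /(_ n (leqnn n))].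
by have [] := uP n.
Unshelve. all: end_near. Qed.

Lemma sqz_time_continuous : continuous (@sqz_time R : sqzS d -> \bar R).
Proof. by move=> z; apply: sqz_seq_cvg => u []. Qed.

Lemma sqz_space_cvg x t :
  @sqz_space R z @[z --> (SqzPt x t : sqzS d)] --> x.
Proof. by apply: sqz_seq_cvg => u [_]; apply. Qed.

(** The converse of the two continuity statements above: closeness of times,
    and of values when the limit time is finite, forces closeness in the metric.
    Otherwise points w n with time and value within 1 / (n + 1) of those of z
    would stay outside a ball around z, yet converge to z. *)
Lemma cvg_sqz (T : Type) (F : set_system T) (u : T -> sqzS d) z : Filter F ->
  sqz_time (u i) @[i --> F] --> sqz_time z ->
  (forall x t, z = SqzPt x t -> sqz_space (u i) @[i --> F] --> x) ->
  u @ F --> z.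
Proof.
move=> FF timeu spaceu.
pose close e w := ball (sqz_time z) e (sqz_time w) /\
  (forall x t, z = SqzPt x t -> ball x e (sqz_space w)).
move=> N /= Nz.
have [e e0 eN] : exists2 e, 0 < e & close e `<=` N.
  apply: contrapT => /forall2NP H.
  have H' n : exists w, close n.+1%:R^-1 w /\ ~ N w.
    apply: contrapT => /forallNP H'.
    have [] := H n.+1%:R^-1; first by rewrite invr_gt0.
    by apply => w wc; apply: contrapT => nw; apply: (H' w).
  have [v vP] := choice H'.
  have : sqz_cvg v z.
    split=> [|x t zE]; apply/cvg_ballP => r r0; near=> n.
      have [[+ _] _] := vP n; apply: le_ball.
      by apply: ltW; near: n; exact: (near_infty_natSinv_lt (PosNum r0)).
    have [[_ /(_ _ _ zE) +] _] := vP n; apply: le_ball.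
    by apply: ltW; near: n; exact: (near_infty_natSinv_lt (PosNum r0)).
  move=> /(sqz_distP d).
  move: Nz => /nbhs_ballP [r /= r0 rN] /cvgrPdist_lt /(_ r r0).
  move=> [n _ /(_ n (leqnn n))] /=.
  rewrite sub0r normrN ger0_norm ?sqz_dist_ge0// sqz_dist_sym.
  by move=> /rN; have [] := vP n.
suff : \forall i \near F, close e (u i) by apply: filterS => i /eN.
apply: filterI; first by move/cvg_ballP : timeu; exact.
case: z {Nz close eN timeu} spaceu => [x t||] spaceu.
- have /cvg_ballP/(_ e e0) := spaceu _ _ erefl.
  by apply: filterS => i H y s [<- _].
- by apply: nearW.
- by apply: nearW.
Unshelve. all: end_near. Qed.

End squeezed_space.

(** * Compactness of the squeezed space and of graphs of continuous paths *)

(** Time, rescaled to [-1, 1] so that distances of times are real numbers and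
    the times -oo and +oo are included. *)
Definition ctime (R : realType) (z : sqz R) : R := contract (sqz_time z).

Section compactness.
Context (R : realType) (d : sqz_metric R).
Implicit Types (z w : sqzS d) (x : \bar R) (t e : R).

Let expand_within (T : Type) (F : set_system T) (f : T -> R) (a : R) :
  Filter F -> f @ F --> a -> `|a| <= 1 -> (\forall i \near F, `|f i| <= 1) ->
  expand (f i) @[i --> F] --> expand a.
Proof.
move=> FF fa a1 f1; apply/cvg_ballP => e e0.
have /cvgrPdist_lt/(_ e e0) := fa.
apply: filterS2 f1 => i f1 afe.
by rewrite /ball/= /ereal_ball !expandK// inE.
Qed.

Lemma ereal_compact : compact [set: \bar R].
Proof.
rewrite [X in compact X](_ : _ = @expand R @` `[-1, 1]%classic).
  apply: continuous_compact; last exact: segment_compact.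
  apply/subspace_continuousP => a /=; rewrite in_itv/= -ler_norml => a1.
  apply: expand_within => //; first exact: cvg_within.
  by apply: filterS (withinT _ _) => b /=; rewrite in_itv/= -ler_norml.
apply/esym; rewrite -subTset => x _ /=; exists (contract x).
  by rewrite in_itv/= -ler_norml contract_le1.
exact: contractK.
Qed.

(** The squeezed space is a quotient of the compact square of extended reals:
    the vertical lines at times -oo and +oo are each collapsed to a point. *)
Lemma sqz_compact : compact [set: sqzS d].
Proof.
pose f (xt : \bar R * \bar R) : sqzS d :=
  match xt.2 with
  | t%:E => SqzPt xt.1 t
  | +oo%E => SqzPinfty
  | -oo%E => SqzNinfty
  end.
have f_time xt : sqz_time (f xt) = xt.2 by case: xt => x [].
rewrite [X in compact X](_ : _ = f @` [set: \bar R * \bar R]); last first.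
  apply/esym; rewrite -subTset => -[x t||] _ /=.
  - by exists (x, t%:E).
  - by exists (0%E, -oo%E).
  - by exists (0%E, +oo%E).
apply: continuous_compact; last first.
  by rewrite -setXTT; apply: compact_setX; exact: ereal_compact.
apply: continuous_subspaceT => -[x0 t0]; apply: cvg_sqz.
  under eq_fun do rewrite f_time.
  by rewrite f_time; exact: cvg_snd.
move=> x t; rewrite /f; case: t0 => [t0||] //= [<- _].
(* near a finite time the map keeps the space coordinate *)
suff : \forall xt \near ((x0, t0%:E) : \bar R * \bar R),
    sqz_space (f xt) = xt.1.
  move=> H; apply: (cvg_trans _ (@cvg_fst _ _ (nbhs x0) (nbhs t0%:E) _)).
  by apply: near_eq_cvg; apply: filterS H => ? ->.
exists (setT, EFin @` setT) => /=; last by case=> y [s||] [_ []].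
split; first exact: filterT.
have H : \forall s \near t0, (EFin @` setT) s%:E.
  by apply: (@nearW _ (nbhs t0)) => s; exists s.
exact: H.
Qed.

Lemma ctime_continuous : continuous (@ctime R : sqzS d -> R).
Proof.
move=> z; apply/(@cvgrPdist_lt _ _ _ (nbhs z) _ (@ctime R) (ctime z)) => e e0.
exact: (@cvg_ball _ _ _ (nbhs z) _ _ _ (@sqz_time_continuous R d z) e e0).
Qed.

(** Heine-Cantor for the rescaled time on the compact squeezed space. *)
Lemma ctime_unif e : 0 < e -> exists2 r, 0 < r &
  forall z w, d z w < r -> `|ctime z - ctime w| < e.
Proof.
move=> e0.
have /compact_near_coveringP cov := sqz_compact.
have : \forall r \near 0^'+, [set: sqzS d] `<=`
    (fun z => forall w, d z w < r -> `|ctime z - ctime w| < e).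
  apply: cov => z _.
  have e20 : 0 < e / 2 by rewrite divr_gt0.
  have /cvgrPdist_lt/(_ _ e20)/nbhs_ballP[r /= r0 rz] := @ctime_continuous z.
  have r20 : 0 < r / 2 by rewrite divr_gt0.
  near=> z' r' => w z'w.
  have zz' : ball z (r / 2) z' by near: z'; exact: nbhsx_ballx.
  have r'r : r' < r / 2 by near: r'; exact: nbhs_right_lt.
  have zw : ball z r w.
    by rewrite (splitr r); apply: ball_triangle zz' (lt_trans z'w r'r).
  have {}zz' : ball z r z' by apply: le_ball zz'; lra.
  have := rz _ zz'; have := rz _ zw => /=.
  rewrite !ltr_norml => /andP[? ?] /andP[? ?]; apply/andP; split; lra.
move=> H; near (0:R)^'+ => r; exists r => //.
by move=> z w; apply: (near H r).
Unshelve. all: end_near. Qed.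

End compactness.

Section paths.
Context (R : realType) (d : sqz_metric R).
Implicit Types (z w : sqzS d) (x : \bar R) (t e : R) (p q : cpath d).

Definition cgraph p : set (sqzS d) := closed_graph (val p).

Lemma cpath_lrval p t : dom (val p) t -> lval (val p) t = rval (val p) t.
Proof. by have /set_mem := valP p; apply. Qed.

Lemma cgraph_pt p x t :
  cgraph p (SqzPt x t) <-> dom (val p) t /\ x = lval (val p) t.
Proof.
split=> [[pt]|[pt ->]]; last by split => //; left.
by rewrite -cpath_lrval// => -[] ->.
Qed.

Lemma cgraph_time p z : cgraph p z -> edom (val p) (sqz_time z).
Proof. by case: z => [x t [] ||]. Qed.

(** This is where continuity of the path matters: a jump would put two points
    above the same time. *)
Lemma cgraph_inj p z w :
  cgraph p z -> cgraph p w -> sqz_time z = sqz_time w -> z = w.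
Proof.
case: z => [x t||]; case: w => [y s||] //=.
move=> /cgraph_pt[pt ->] /cgraph_pt[ps ->] [].
by move=> ->.
Qed.

(** Since the left and right values agree, the two one-sided continuity
    conditions glue to continuity along the domain. *)
Lemma lval_cvg p t : dom (val p) t ->
  lval (val p) s @[s --> within (dom (val p)) (nbhs t)] --> lval (val p) t.
Proof.
move=> pt N Nt.
have L : \forall s \near t, s < t -> dom (val p) s -> N (lval (val p) s).
  exact: (lval_continuous pt Nt).
have Rt : nbhs (rval (val p) t) N by rewrite -cpath_lrval.
have S : \forall s \near t, t < s -> dom (val p) s -> N (rval (val p) s).
  exact: (rval_continuous pt Rt).
suff : \forall s \near t, dom (val p) s -> N (lval (val p) s) by [].
apply: filterS2 L S => s L S; have [st|ts|->] := ltgtP s t => ps.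
- exact: L.
- by rewrite cpath_lrval//; exact: S.
- exact: nbhs_singleton.
Qed.

Lemma edom_compact p : compact (edom (val p)).
Proof.
by apply: subclosed_compact (@ereal_compact R) _ => //; exact: edom_closed.
Qed.

Lemma cgraph_nonempty p : cgraph p !=set0.
Proof.
have [[t||] pt] := edom_nonempty (val p).
- by exists (SqzPt (lval (val p) t) t); apply/cgraph_pt.
- by exists SqzPinfty.
- by exists SqzNinfty.
Qed.

(** The graph is the continuous image of the extended domain.  Continuity at
    the times -oo and +oo is automatic, because neighbourhoods of the two
    points at infinity only constrain time. *)
Lemma cgraph_compact p : compact (cgraph p).
Proof.
pose f (t : \bar R) : sqzS d :=
  match t with
  | t%:E => SqzPt (lval (val p) t) t
  | +oo%E => SqzPinfty
  | -oo%E => SqzNinfty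
  end.
have f_time x : sqz_time (f x) = x by case: x.
rewrite (_ : cgraph p = f @` edom (val p)); last first.
  apply/seteqP; split=> [z pz|_ [t pt <-]].
    exists (sqz_time z); first exact: cgraph_time.
    by case: z pz => [x t||] //= /cgraph_pt[_ ->].
  by case: t pt => //= t pt; apply/cgraph_pt.
apply: continuous_compact; last exact: edom_compact.
apply/subspace_continuousP => t pt; apply: cvg_sqz.
  under eq_fun do rewrite f_time.
  by rewrite f_time; exact: cvg_within.
by case: t pt => [t||] pt x s // [<- _]; exact: (lval_cvg pt).
Qed.

End paths.

(** * On continuous paths the J1 topology is the Hausdorff topology of graphs *)

(** The two inequalities that define a Hausdorff distance less than e, without
    the suprema (which could equal e). *)
Definition hclose (R : realType) (d : sqz_metric R) (e : R)
    (A B : set (sqz R)) : Prop :=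
  (forall z, A z -> exists2 w, B w & d z w < e) /\
  (forall w, B w -> exists2 z, A z & d z w < e).

Section hclose.
Context (R : realType) (d : sqz_metric R).
Implicit Types (A B C : set (sqz R)) (e : R).

Lemma hclose_refl e A : 0 < e -> hclose d e A A.
Proof. by move=> e0; split=> z Az; exists z; rewrite // sqz_distxx. Qed.

Lemma hclose_trans e f A B C :
  hclose d e A B -> hclose d f B C -> hclose d (e + f) A C.
Proof.
move=> [AB BA] [BC CB]; split=> z.
  move=> /AB[w /BC[v Cv wv] zw]; exists v => //.
  by rewrite (le_lt_trans (sqz_dist_triangle _ _ w _))// ltrD.
move=> /CB[w /BA[v Cv wv] zw]; exists v => //.
by rewrite (le_lt_trans (sqz_dist_triangle _ _ w _))// ltrD.
Qed.

Lemma hclose_sym e A B : hclose d e A B -> hclose d e B A.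
Proof.
move=> [AB BA]; split=> z.
  by move=> /BA[w Aw wz]; exists w; rewrite // sqz_dist_sym.
by move=> /AB[w Aw wz]; exists w; rewrite // sqz_dist_sym.
Qed.

Lemma le_hclose e f A B : e <= f -> hclose d e A B -> hclose d f A B.
Proof.
move=> ef [AB BA]; split=> z.
  by move=> /AB[w Bw zw]; exists w => //; exact: lt_le_trans ef.
by move=> /BA[w Bw zw]; exists w => //; exact: lt_le_trans ef.
Qed.

Lemma dJ1_hclose (p q : jpath R) e :
  (dJ1 d p q < e%:E)%E -> hclose d e (closed_graph p) (closed_graph q).
Proof.
move=> /ereal_inf_lt[_ [C [[Csub Cl Cr] _] <-] Ce].
have dC z w : C (z, w) -> d z w < e.
  move=> Czw; rewrite -lte_fin; apply: le_lt_trans Ce.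
  by apply: ereal_sup_ubound; exists (z, w).
split=> [z /Cl[w Czw]|w /Cr[z Czw]].
  by exists w; [have [] := Csub _ Czw|exact: dC].
by exists z; [have [] := Csub _ Czw|exact: dC].
Qed.

End hclose.

(** Matching points of two sets of reals with their nearest neighbours never
    creates a crossing.  If a < a' were matched with b > b', then, whichever
    point of each pair has the other one as its nearest neighbour, one of them
    would be strictly closer to its partner in (a, b') or (a', b). *)
Lemma nearest_monotone (R : realDomainType) (a a' b b' : R) :
  a < a' -> b' < b ->
  `|a - b| <= `|a - b'| \/ `|a - b| <= `|a' - b| ->
  `|a' - b'| <= `|a' - b| \/ `|a' - b'| <= `|a - b'| -> False.
Proof.
move=> aa' bb'.
have le1 : a - b <= `|a - b| := ler_norm _.
have le2 : b - a <= `|a - b| by rewrite distrC ler_norm.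
have le3 : a' - b' <= `|a' - b'| := ler_norm _.
have le4 : b' - a' <= `|a' - b'| by rewrite distrC ler_norm.
case: (ger0P (a - b')) => ?; case: (ger0P (a' - b)) => ?;
  by move=> [?|?] [?|?]; lra.
Qed.

Section path_topology.
Context (R : realType) (d : sqz_metric R).
Implicit Types (z w : sqzS d) (e : R) (p q : cpath d).

(** Uniform continuity of a continuous path, including at infinite times.  Near
    a diagonal pair of graph points the distance is small, and near any other
    pair the times stay apart, as distinct graph points have distinct times. *)
Lemma cgraph_equicont p e : 0 < e -> exists2 r, 0 < r &
  forall z w, cgraph p z -> cgraph p w -> `|ctime z - ctime w| < r -> d z w < e.
Proof.
move=> e0.
have cpp : compact (cgraph p `*` cgraph p).
  by apply: compact_setX; exact: cgraph_compact.
move/compact_near_coveringP : cpp => cov.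
have : \forall r \near 0^'+, cgraph p `*` cgraph p `<=`
    (fun zw => `|ctime zw.1 - ctime zw.2| < r -> d zw.1 zw.2 < e).
  apply: cov => -[z w] [/= pz pw].
  have [zw|zw] := eqVneq z w.
    rewrite -{}zw {w pw}.
    have z2 : nbhs z (ball z (e / 2)) by apply: nbhsx_ballx; rewrite divr_gt0.
    exists ((ball z (e / 2) `*` ball z (e / 2)), setT) => /=.
      split; last exact: filterT.
      by exists (ball z (e / 2), ball z (e / 2)).
    move=> [[z' w'] r] [[/= zz' zw'] _] _.
    by have := ball_splitr zz' zw'.
  have tzw : 0 < `|ctime z - ctime w|.
    rewrite normr_gt0 subr_eq0; apply: contra_neq zw => /contract_inj.
    exact: (cgraph_inj pz pw).
  set c := `|ctime z - ctime w| in tzw; have c3 : 0 < c / 3 by rewrite divr_gt0.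
  pose N (v : sqzS d) := [set v' : sqzS d | `|ctime v - ctime v'| < c / 3].
  have nbhsN v : nbhs v (N v).
    by have /cvgrPdist_lt/(_ _ c3) := @ctime_continuous R d v.
  exists (N z `*` N w, [set r | r < c / 3]) => /=.
    by split; [exists (N z, N w)|exact: nbhs_right_lt].
  move=> [[z' w'] r] [[/= zz' ww'] rc] /= zwr; exfalso.
  have : c < c; last by rewrite ltxx.
  rewrite {1}/c (_ : ctime z - ctime w =
    (ctime z - ctime z') + (ctime z' - ctime w') - (ctime w - ctime w'));
    last by ring.
  rewrite (le_lt_trans (ler_normB _ _))//.
  rewrite (_ : c = c / 3 + c / 3 + c / 3); last by lra.
  rewrite ltrD// (le_lt_trans (ler_normD _ _))// ltrD//.
  exact: lt_trans rc.
move=> H; near (0:R)^'+ => r; exists r => // z w pz pw.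
by apply: (near H r _ (z, w)).
Unshelve. all: end_near. Qed.

Lemma exists_nearest p z : exists2 w, cgraph p w &
  forall w', cgraph p w' -> `|ctime z - ctime w| <= `|ctime z - ctime w'|.
Proof.
have cf : {within cgraph p, continuous (fun w => `|ctime z - ctime w|)}.
  apply: continuous_subspaceT => w.
  apply: (@cvg_norm _ _ _ (nbhs w)).
  apply: (@cvgB _ _ _ (nbhs w)); first exact: cvg_cst.
  exact: ctime_continuous.
have [w /set_mem pw wmin] :=
  compact_EVT_min (cgraph_nonempty p) (@cgraph_compact _ _ p) cf.
by exists w => // w' /mem_set; exact: wmin.
Qed.

Lemma cgraph_path_lt p z w :
  cgraph p z -> cgraph p w -> path_lt (val p) z w -> ctime z < ctime w.
Proof.
move=> pz pw; rewrite lt_contract => -[//|[t [x [y [zE wE [xy _]]]]]].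
move: pz pw; rewrite zE wE => /cgraph_pt[_ xE] /cgraph_pt[_ yE].
by case: xy; rewrite xE.
Qed.

(** Two paths p' and q whose graphs are close to that of p are J1-close.  The
    correspondence joins points that are nearest in time; matched points have
    nearby times because the graphs are close, and p transfers this to nearby
    positions by its modulus of continuity.  Having two moving paths, instead of
    comparing q with p, stands in for a triangle inequality of the J1 distance,
    whose proof would require composing correspondences. *)
Lemma hclose_cdJ1 p e : 0 < e -> exists2 r, 0 < r &
  forall p' q, hclose d r (cgraph p) (cgraph p') ->
    hclose d r (cgraph p) (cgraph q) ->
    (cdJ1 p' q < e%:E)%E.
Proof.
move=> e0.
have e4 : 0 < e / 4 by rewrite divr_gt0.
have [s s0 ps] := cgraph_equicont p e4.
have s4 : 0 < s / 4 by rewrite divr_gt0.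
have [r r0 rs] := ctime_unif d s4.
(* Matched times differ by less than s / 4, and passing from p' and q to p costs
   s / 4 at each end, so p sees a time difference below s; distances then add up
   to e / 8 + e / 4 + e / 8 = e / 2. *)
exists (Num.min (r / 2) (e / 8)); first by rewrite lt_min !divr_gt0.
set m := Num.min _ _.
have mr : m + m <= r.
  by have := ge_min (r / 2) (r / 2) (e / 8); rewrite lexx -/m /=; lra.
have me : m <= e / 8 by rewrite ge_min lexx orbT.
have m0 : 0 < m by rewrite lt_min !divr_gt0.
move=> p' q pp' pq.
have p'q := hclose_trans (hclose_sym pp') pq.
pose C := [set zw : sqz R * sqz R | [/\ cgraph p' zw.1, cgraph q zw.2 &
  (forall w', cgraph q w' ->
    `|ctime zw.1 - ctime zw.2| <= `|ctime zw.1 - ctime w'|) \/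
  (forall z', cgraph p' z' ->
    `|ctime zw.1 - ctime zw.2| <= `|ctime z' - ctime zw.2|)]].
have Ctime z w : C (z, w) -> `|ctime z - ctime w| < s / 4.
  move=> [/= pz qw [near_z|near_w]].
    have [w' qw' zw'] := proj1 p'q _ pz.
    apply: le_lt_trans (near_z _ qw') _; apply: rs.
    exact: lt_le_trans mr.
  have [z' pz' zw'] := proj2 p'q _ qw.
  apply: le_lt_trans (near_w _ pz') _; apply: rs.
  exact: lt_le_trans mr.
have Cdist z w : C (z, w) -> d z w <= e / 2.
  move=> Czw; have zw := Ctime _ _ Czw; have [/= pz qw _] := Czw.
  have [z0 pz0 zz0] := proj2 pp' _ pz; have [w0 pw0 ww0] := proj2 pq _ qw.
  have tz : `|ctime z0 - ctime z| < s / 4 by apply: rs; lra.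
  have tw : `|ctime w0 - ctime w| < s / 4 by apply: rs; lra.
  have : d z0 w0 < e / 4.
    apply: ps => //.
    move: tz tw zw; rewrite !ltr_norml => /andP[? ?] /andP[? ?] /andP[? ?].
    by apply/andP; split; lra.
  have := sqz_dist_triangle d z z0 w; have := sqz_dist_triangle d z0 w0 w.
  rewrite (sqz_dist_sym d z z0); lra.
have Cmono : monotone_corr (val p') (val q) C.
  split.
    split.
    - by move=> [z w] [].
    - move=> z pz; have [w qw wmin] := exists_nearest q z.
      by exists w; split => //; left.
    - move=> w qw; have [z pz zmin] := exists_nearest p' w.
      exists z; split => //; right=> z' pz' /=.
      by rewrite distrC (distrC (ctime z')); exact: zmin.
  move=> [z1 [z2 [z1' [z2' [[/= p1 q2 C1] [/= p1' q2' C2] l1 l2]]]]].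
  have {}l1 := cgraph_path_lt p1 p1' l1; have {}l2 := cgraph_path_lt q2' q2 l2.
  apply: (nearest_monotone l1 l2).
    by case: C1 => H; [left|right]; exact: H.
  by case: C2 => H; [left|right]; exact: H.
apply: (@le_lt_trans _ _ (e / 2)%:E); last by rewrite lte_fin; lra.
apply: ge_ereal_inf; exists (ereal_sup [set (d z.1 z.2)%:E | z in C]).
  by exists C.
by apply: ge_ereal_sup => _ [[z w] Czw <-]; rewrite lee_fin; exact: Cdist.
Qed.

(** By [hclose_cdJ1] Hausdorff-close paths lie in a J1-ball.  For the converse,
    closeness by some e < r instead of r defines a J1-open set, thanks
    to the triangle inequality for graphs. *)
Lemma nbhs_cpathP p (U : set (cpath d)) : nbhs p U <->
  exists2 r, 0 < r & forall q, hclose d r (cgraph p) (cgraph q) -> U q.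
Proof.
split.
  rewrite nbhsE => -[B [[V oV <-] Vp] BU].
  have [e e0 eV] := oV _ Vp.
  have [r r0 H] := hclose_cdJ1 p e0.
  exists r => // q pq; apply: BU; apply: eV; apply: H => //.
  exact: hclose_refl.
move=> [r r0 rU]; rewrite nbhsE.
pose V : set (pathJ1 d) :=
  [set q | exists2 e, e < r & hclose d e (cgraph p) (closed_graph q)].
exists (val @^-1` V); last first.
  by move=> q [e er pq]; apply: rU; apply: le_hclose pq; exact: ltW.
split; last first.
  exists (r / 2); first by lra.
  by apply: hclose_refl; rewrite divr_gt0.
suff oV : dist_open (dJ1 d) V by exists V.
move=> q [e er pq]; exists ((r - e) / 2); first by lra.
move=> q' /dJ1_hclose qq'; exists (e + (r - e) / 2); first by lra.
exact: hclose_trans qq'.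
Qed.

End path_topology.

(** * Limits of compact sets along an ultrafilter *)

(** For a family of sets k indexed by J and an ultrafilter F on J, the limit set
    collects the points near which k is eventually present.  For an ultrafilter
    the upper and lower Kuratowski limits coincide, which makes k converge to
    this set in the Vietoris sense once it is confined to a compact set. *)
Section ultralimit.
Context (X : topologicalType) (J : Type) (k : J -> set X).
Context (F : set_system J) {UF : UltraFilter F}.
Implicit Types (Q V N : set X).

Let PF : ProperFilter F := ultra_proper.

Definition ultralim : set X :=
  [set x | forall N, nbhs x N -> F [set j | k j `&` N !=set0]].

Let not_ultralim x : ~ ultralim x ->
  exists2 N, nbhs x N & F [set j | k j `&` N = set0].
Proof.
move=> /existsNP[N /not_implyP[xN nF]]; exists N => //.
have [//|FN] := in_ultra_setVsetC [set j | k j `&` N !=set0] UF.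
by apply: filterS FN => j /set0P/negP/negPn/eqP.
Qed.

(** Each point of Q has a neighbourhood that k eventually misses, and finitely
    many of them cover Q. *)
Lemma ultralim_disjoint Q : compact Q -> Q `&` ultralim `<=` set0 ->
  \forall j \near F, k j `&` Q `<=` set0.
Proof.
move=> /compact_near_coveringP cov QL.
have : \forall j \near F, Q `<=` (fun x => ~ k j x).
  apply: cov => x Qx.
  have /not_ultralim[N xN FN] : ~ ultralim x by move=> Lx; exact: (QL x).
  exists (N, [set j | k j `&` N = set0]) => // -[y j] [/= Ny kN] kjy.
  by have : (k j `&` N) y by []; rewrite kN.
by apply: filterS => j H x [kx /H].
Qed.

Lemma ultralim_closed : closed ultralim.
Proof.
move=> x clx N /nbhs_interior xN.
have [y [Ly yN]] := clx _ xN; exact: Ly.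
Qed.

Lemma ultralim_subclosed Q :
  closed Q -> (\forall j \near F, k j `<=` Q) -> ultralim `<=` Q.
Proof.
move=> clQ FQ x Lx; apply: contrapT => nQx.
have : nbhs x (~` Q) by apply: open_nbhs_nbhs; split => //; exact: closed_openC.
move=> /Lx FN; have [j [[y [ky +]] kQ]] := filter_ex (filterI FN FQ).
by apply; exact: kQ.
Qed.

Lemma ultralim_near_open Q V : compact Q -> (\forall j \near F, k j `<=` Q) ->
  open V -> ultralim `<=` V -> \forall j \near F, k j `<=` V.
Proof.
move=> cQ FQ oV LV.
have cQV : compact (Q `&` ~` V).
  by apply: compact_closedI => //; exact: open_closedC.
have QVL : (Q `&` ~` V) `&` ultralim `<=` set0 by move=> x [[_ nV] /LV].
apply: filterS2 FQ (ultralim_disjoint cQV QVL) => j kQ kQV x kx.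
by apply: contrapT => nVx; apply: (kQV x); split => //; split => //; exact: kQ.
Qed.

Lemma ultralim_nonempty Q : compact Q -> (\forall j \near F, k j `<=` Q) ->
  (forall j, k j !=set0) -> ultralim !=set0.
Proof.
move=> cQ FQ k0; apply: contrapT => /set0P/negP/negPn/eqP L0.
have FQ0 : \forall j \near F, k j `&` Q `<=` set0.
  by apply: ultralim_disjoint => //; rewrite L0 setI0.
have [j [kQ kQ0]] := filter_ex (filterI FQ FQ0).
by have [x kx] := k0 j; apply: (kQ0 x); split => //; exact: kQ.
Qed.

End ultralimit.

(** * Closed sets that are graphs of continuous paths *)

(** A nonempty closed set with at most one point above each real time is the
    graph of a continuous path: compactness turns uniqueness of the value into
    continuity. *)
Section path_of_graph.
Context (R : realType) (d : sqz_metric R) (G : set (sqzS d)).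
Context (G0 : G !=set0) (clG : closed G).
Context (G_functional :
  forall x y t, G (SqzPt x t) -> G (SqzPt y t) -> x = y).

Let E : set (\bar R) := @sqz_time R @` G.

Let v (t : R) : \bar R := xget 0%E [set x | G (SqzPt x t)].

Let cG : compact G.
Proof. exact: subclosed_compact clG (@sqz_compact R d) _. Qed.

Let E_Pt t : real_times E t -> G (SqzPt (v t) t).
Proof.
move=> [[x s||] // Gxs [st]]; rewrite -st.
by apply: (@xgetPex _ 0%E [set x | G (SqzPt x s)]); exists x.
Qed.

Let v_out t : ~ real_times E t -> v t = 0%E.
Proof.
by move=> nEt; apply: xgetPN => x Gx; apply: nEt; exists (SqzPt x t).
Qed.

Let v_cvg t : real_times E t ->
  v s @[s --> within (real_times E) (nbhs t)] --> v t.
Proof.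
move=> Et N Nt.
move: cG => /compact_near_coveringP cov.
have : \forall s \near t, G `<=`
    (fun z => sqz_time z = s%:E -> N (sqz_space z)).
  apply: (cov _ (nbhs t)
    (fun s z => sqz_time z = s%:E -> N (sqz_space z))) => z Gz.
  have [zt|zt] := pselect (sqz_time z = t%:E).
    have -> : z = SqzPt (v t) t.
      case: z Gz zt => [x s||] // Gz [st]; rewrite st in Gz *.
      by rewrite (G_functional Gz (E_Pt Et)).
    have NN := @sqz_space_cvg R d (v t) t N Nt.
    exists (@sqz_space R @^-1` N, setT).
      by split; [exact: NN|exact: filterT].
    by move=> [z' s] [].
  have := @ereal_hausdorff R; rewrite open_hausdorff => /(_ (sqz_time z) t%:E).
  move=> /(_ (introN eqP zt))[[U V] /= [/set_mem Uz /set_mem Vt] [oU oV UV]].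
  exists (@sqz_time R @^-1` U, EFin @^-1` V).
    split => /=.
      apply: (@sqz_time_continuous R d z U).
      by apply: open_nbhs_nbhs.
    by have : nbhs t%:E V by apply: open_nbhs_nbhs.
  move=> [z' s] [/= Uz' Vs] zs; exfalso.
  have : (U `&` V) s%:E by split => //; rewrite -zs.
  by rewrite (eqP UV).
suff H : (\forall s \near t, G `<=`
    (fun z => sqz_time z = s%:E -> N (sqz_space z))) ->
    \forall s \near t, real_times E s -> N (v s) by move=> /H.
by apply: filterS => s GN Es; exact: (GN _ (E_Pt Es)).
Qed.

Let v_left t : real_times E t ->
  v s @[s --> within (real_times E) t^'-] --> v t.
Proof.
move=> Et N Nt.
suff : \forall s \near t, s < t -> real_times E s -> N (v s) by [].
have : \forall s \near t, real_times E s -> N (v s) := v_cvg Et Nt.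
by apply: filterS => s H _.
Qed.

Let v_right t : real_times E t ->
  v s @[s --> within (real_times E) t^'+] --> v t.
Proof.
move=> Et N Nt.
suff : \forall s \near t, t < s -> real_times E s -> N (v s) by [].
have : \forall s \near t, real_times E s -> N (v s) := v_cvg Et Nt.
by apply: filterS => s H _.
Qed.

Let E0 : E !=set0. Proof. by have [z Gz] := G0; exists (sqz_time z), z. Qed.

Let clE : closed E.
Proof.
apply: compact_closed; first exact: ereal_hausdorff.
apply: continuous_compact => //.
by apply: continuous_subspaceT; exact: (@sqz_time_continuous R d).
Qed.

Lemma path_of_graph : exists p : cpath d, cgraph p = G.
Proof.
pose p : jpath R := @JPath R E v v E0 clE v_left v_right
  (fun t lt => v_left lt.1) (fun t lt => v_right lt.1) v_out v_out.
have cp : (p : pathJ1 d) \in @is_continuous_path R d by apply/mem_set.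
exists (exist _ (p : pathJ1 d) cp); apply/seteqP; split => z.
- case: z => [x t||].
  + by move=> /cgraph_pt[/= /E_Pt Gt ->].
  + by move=> [[]].
  + by move=> [[]].
- case: z => [x t||] Gz; last 2 first.
  + by exists SqzNinfty.
  + by exists SqzPinfty.
  have Et : real_times E t by exists (SqzPt x t).
  by apply/cgraph_pt; split => //=; exact: G_functional Gz (E_Pt Et).
Qed.

End path_of_graph.

(** * Pairs of points on the graph of a path *)

Section pairs.
Context (R : realType) (d : sqz_metric R).
Implicit Types (z w : sqzS d) (p q : cpath d) (B : set (sqzS d * sqzS d)).

Definition hits p B := exists z w, [/\ cgraph p z, cgraph p w & B (z, w)].

(** Hausdorff-close graphs contain pairs close to a given pair. *)
Lemma open_hits B : open B -> open [set p | hits p B].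
Proof.
move=> oB; rewrite openE => p [z [w [pz pw Bzw]]]; rewrite /interior.
have : nbhs (z, w) B by apply: open_nbhs_nbhs.
move=> /nbhs_ballP[r /= r0 rB]; apply/nbhs_cpathP; exists r => // q [pq _].
have [z' qz' zz'] := pq _ pz; have [w' qw' ww'] := pq _ pw.
by exists z', w'; split => //; apply: rB.
Qed.

(** A compact set disjoint from a closed one has positive distance to it. *)
Lemma closed_hits B : closed B -> closed [set p | hits p B].
Proof.
move=> clB; rewrite -openC openE => p npB; rewrite /interior.
have cpp : compact (cgraph p `*` cgraph p).
  by apply: compact_setX; exact: cgraph_compact.
move/compact_near_coveringP : cpp => cov.
have : \forall r \near 0^'+, cgraph p `*` cgraph p `<=`
    (fun zw => forall z w, d zw.1 z < r -> d zw.2 w < r -> ~ B (z, w)).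
  apply: (cov _ 0^'+ (fun r zw =>
    forall z w, d zw.1 z < r -> d zw.2 w < r -> ~ B (z, w))).
  move=> [z w] [/= pz pw].
  have : nbhs (z, w) (~` B).
    apply: open_nbhs_nbhs; split; first exact: closed_openC.
    by move=> Bzw; apply: npB; exists z, w.
  move=> /nbhs_ballP[r /= r0 rB].
  exists (ball (z, w) (r / 2), [set s | s < r / 2]) => /=.
    split; first by apply: nbhsx_ballx; rewrite divr_gt0.
    by apply: nbhs_right_lt; rewrite divr_gt0.
  move=> [[z' w'] s] [[/= zz' ww'] sr] z'' w'' zs ws.
  apply: rB; split => /=; rewrite (splitr r).
    by apply: (ball_triangle zz'); exact: lt_trans sr.
  by apply: (ball_triangle ww'); exact: lt_trans sr.
move=> H; near (0:R)^'+ => r.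
apply/nbhs_cpathP; exists r => // q [_ qp] [z [w [qz qw]]].
have [z' pz' zz'] := qp _ qz; have [w' pw' ww'] := qp _ qw.
by apply: (near H r _ (z', w')).
Unshelve. all: end_near. Qed.

(** Vietoris convergence to a compact limit is convergence in the Hausdorff
    metric. *)
Lemma near_hclose_ultralim (F : set_system (cpath d)) (r : R) :
  UltraFilter F -> 0 < r ->
  \forall q \near F, hclose d r (ultralim (@cgraph R d) F) (cgraph q).
Proof.
move=> UF r0; pose G := ultralim (@cgraph R d) F.
have PF : ProperFilter F := ultra_proper.
have cG : compact G.
  exact: subclosed_compact (@ultralim_closed _ _ _ _) (@sqz_compact R d) _.
apply: filterI.
  have r20 : 0 < r / 2 by rewrite divr_gt0.
  move/compact_near_coveringP : cG => cov.
  apply: (cov _ F (fun q z => exists2 w, cgraph q w & d z w < r)) => z Gz.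
  have zr : nbhs z (ball z (r / 2)) by exact: nbhsx_ballx.
  exists (ball z (r / 2), [set q | cgraph q `&` ball z (r / 2) !=set0]).
    by split => //; exact: Gz.
  move=> [z' q] [/= zz' [w [qw zw]]]; exists w => //.
  exact: (ball_splitr zz' zw).
(* The union of the balls is a neighbourhood of G, and its interior an open
   one. *)
pose V := (\bigcup_(z in G) ball z r)°.
have GV : G `<=` V.
  move=> z Gz; have : nbhs z (ball z r) by exact: nbhsx_ballx.
  by apply: filterS => w zw; exists z.
have : \forall q \near F, cgraph q `<=` V.
  apply: ultralim_near_open (@sqz_compact R d) _ _ GV => //.
  - by apply: nearW.
  - exact: open_interior.
apply: filterS => q qV w qw.
by have /interior_subset[z Gz zw] := qV _ qw; exists z.
Qed.

(** A compactness criterion in terms of forbidden pairs: if every two points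
    above the same time are separated by a neighbourhood of forbidden pairs, the
    limit of graphs avoiding all of them has one point above each time.  The
    interiors make the avoiding set closed, hence stable under limits. *)
Lemma compact_avoid (I : Type) (B : I -> set (sqzS d * sqzS d)) :
  (forall x y t, (x < y)%E -> exists i,
    nbhs ((SqzPt x t, SqzPt y t) : sqzS d * sqzS d) (B i)) ->
  compact [set p | forall i, ~ hits p (B i)°].
Proof.
move=> Bxy; set E := [set p | _]; rewrite compact_ultra => F UF FE.
have PF : ProperFilter F := ultra_proper.
pose G := ultralim (@cgraph R d) F.
have G_lt x y t : (x < y)%E -> G (SqzPt x t) -> ~ G (SqzPt y t).
  move=> /Bxy - /(_ t)[i /nbhs_interior[[N M] /= [xN yM] NM]] Gx Gy.
  have [q [[Eq [z [qz Nz]]] [w [qw Mw]]]] :=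
    filter_ex (filterI (filterI FE (Gx _ xN)) (Gy _ yM)).
  by apply: (Eq i); exists z, w; split => //; apply: NM.
have G_fun x y t : G (SqzPt x t) -> G (SqzPt y t) -> x = y.
  by move=> Gx Gy; have [/G_lt/(_ Gx)|/G_lt/(_ Gy)|] := ltgtP x y.
have G0 : G !=set0.
  apply: ultralim_nonempty (@sqz_compact R d) _ _; last exact: cgraph_nonempty.
  by apply: nearW.
have [p pG] := path_of_graph G0 (@ultralim_closed _ _ _ _) G_fun.
have Fp : F --> p.
  move=> U /nbhs_cpathP[r r0 rU].
  have := near_hclose_ultralim UF r0.
  by apply: filterS => q; rewrite -/G -pG; exact: rU.
exists p; split => // i pB.
have : nbhs p [set q | hits q (B i)°].
  by apply: open_nbhs_nbhs; split => //; apply: open_hits; exact: open_interior.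
by move=> /Fp FB; have [q [qB Eq]] := filter_ex (filterI FB FE); exact: (Eq i).
Qed.

End pairs.

(** * Oscillation across a level *)

Lemma hausdorff_prod (X Y : topologicalType) :
  hausdorff_space X -> hausdorff_space Y -> hausdorff_space (X * Y)%type.
Proof.
move=> hX hY [x y] [x' y'] xy; congr pair.
- apply: hX => A B xA x'B.
  have xyA : nbhs (x, y) (fst @^-1` A) by exact: (@cvg_fst _ _ (nbhs x)).
  have xyB : nbhs (x', y') (fst @^-1` B) by exact: (@cvg_fst _ _ (nbhs x')).
  by have [ab [? ?]] := xy _ _ xyA xyB; exists ab.1.
- apply: hY => A B yA y'B.
  have xyA : nbhs (x, y) (snd @^-1` A) by exact: (@cvg_snd _ _ (nbhs x)).
  have xyB : nbhs (x', y') (snd @^-1` B) by exact: (@cvg_snd _ _ (nbhs x')).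
  by have [ab [? ?]] := xy _ _ xyA xyB; exists ab.2.
Qed.

Section oscillation.
Context (R : realType) (d : sqz_metric R).
Implicit Types (T delta eps r : R) (p : cpath d).

(** The low point and the high point may come in either order in time, so that
    one set of pairs accounts for upward and downward oscillations. *)
Definition osc T delta eps r : set (sqzS d * sqzS d) :=
  [set zw | exists x s y t, [/\ zw = (SqzPt x s, SqzPt y t),
    `|s| <= T, `|t| <= T & `|s - t| <= delta] /\
    ((x <= r%:E)%E /\ ((r + eps)%:E <= y)%E)].

(** The two times cannot coincide, since a continuous path has one value at each
    time and eps is positive; so the order of the two graph points is that of
    their times. *)
Lemma S2_hits T delta eps r p : 0 < eps ->
  S2 T delta eps r (val p) <-> hits p (osc T delta eps r).
Proof.
move=> eps0.
have re0 : (r%:E < (r + eps)%:E)%E by rewrite lte_fin ltrDl.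
split.
- move=> [|] [x [y [[s [t [[Ts st tT std] [/= ps pt _]]]] xr yr]]].
  + exists (SqzPt x s), (SqzPt y t); split => //; exists x, s, y, t.
    by do !split => //; rewrite ler_norml; apply/andP; split; lra.
  + exists (SqzPt y t), (SqzPt x s); split => //; exists y, t, x, s.
    by do !split => //; rewrite ler_norml; apply/andP; split; lra.
- move=> [z [w [pz pw [x [s [y [t [[[zE wE] sT tT std] [xr ry]]]]]]]]].
  rewrite {}zE in pz; rewrite {}wE in pw.
  move: sT tT std; rewrite !ler_norml => /andP[? ?] /andP[? ?] /andP[? ?].
  have [st|ts|st] := ltgtP s t.
  + left; exists x, y; split => //; exists s, t; split; first by split; lra.
    by split => //; left; left => /=; rewrite lte_fin.
  + right; exists y, x; split => //; exists t, s; split; first by split; lra.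
    by split => //; left; left => /=; rewrite lte_fin.
  + move: pz pw; rewrite st => /cgraph_pt[_ xE] /cgraph_pt[_ yE].
    by have := le_lt_trans xr (lt_le_trans re0 ry); rewrite xE yE ltxx.
Qed.

Lemma le_osc T delta delta' eps r : delta <= delta' ->
  osc T delta eps r `<=` osc T delta' eps r.
Proof.
move=> dd' _ [x [s [y [t [[-> sT tT std] xy]]]]]; exists x, s, y, t.
by split => //; split => //; exact: le_trans dd'.
Qed.

Let SqzPt_continuous (xs : \bar R * R) :
  (SqzPt ys.1 ys.2 : sqzS d) @[ys --> xs] --> (SqzPt xs.1 xs.2 : sqzS d).
Proof.
case: xs => x s; apply: cvg_sqz => /=.
  have H : EFin r @[r --> s] --> s%:E by [].
  by apply: (cvg_comp _ _ _ H); exact: cvg_snd.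
by move=> _ _ [<- _]; exact: cvg_fst.
Qed.

(** Restricting times to [-T, T] makes this a continuous image of a compact set;
    without it, pairs could escape to the points at infinity, where values are
    lost. *)
Lemma closed_osc T delta eps r : closed (osc T delta eps r).
Proof.
pose K : set ((\bar R * R) * (\bar R * R)) :=
  ([set x | (x <= r%:E)%E] `*` `[- T, T]%classic) `*`
  ([set y | ((r + eps)%:E <= y)%E] `*` `[- T, T]%classic).
pose D := [set v : (\bar R * R) * (\bar R * R) | `|v.1.2 - v.2.2| <= delta].
pose f (v : (\bar R * R) * (\bar R * R)) : sqzS d * sqzS d :=
  (SqzPt v.1.1 v.1.2, SqzPt v.2.1 v.2.2).
have cK : compact (K `&` D).
  apply: compact_closedI.
    by do !apply: compact_setX; try exact: segment_compact;
      apply: subclosed_compact (@ereal_compact R) _ => //;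
      [exact: closed_ereal_ge_ereal|exact: closed_ereal_le_ereal].
  have -> : D = (fun v => `|v.1.2 - v.2.2|) @^-1` [set u | u <= delta] by [].
  apply: preimage_closed; last exact: closed_le.
  move=> [[x s] [y t]] _; apply: cvg_norm; apply: cvgB.
    by apply: (@cvg_comp _ _ _ (fun v => v.1) (fun v => v.2) _ (nbhs (x, s)));
      [exact: cvg_fst|exact: cvg_snd].
  by apply: (@cvg_comp _ _ _ (fun v => v.2) (fun v => v.2) _ (nbhs (y, t)));
    [exact: cvg_snd|exact: cvg_snd].
rewrite (_ : osc _ _ _ _ = f @` (K `&` D)).
  apply: compact_closed.
    by apply: hausdorff_prod; exact: (@metric_hausdorff R).
  apply: continuous_compact => //; apply: continuous_subspaceT => -[v w].
  apply: (@cvg_pair _ _ _ (nbhs (v, w)) (nbhs (SqzPt v.1 v.2 : sqzS d))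
    (nbhs (SqzPt w.1 w.2 : sqzS d))).
    by apply: (@cvg_comp _ _ _ (fun v => v.1) (fun v => SqzPt v.1 v.2) _
      (nbhs v));
      [exact: cvg_fst|exact: SqzPt_continuous].
  by apply: (@cvg_comp _ _ _ (fun v => v.2) (fun v => SqzPt v.1 v.2) _
    (nbhs w));
    [exact: cvg_snd|exact: SqzPt_continuous].
apply/seteqP; split=> [_ [x [s [y [t [[-> sT tT st] [xr ry]]]]]]|].
  exists ((x, s), (y, t)) => //; do !split => //=;
  by rewrite in_itv/= -ler_norml.
move=> _ [[[x s] [y t]] [[[/= xr sT] [/= yr tT]] st] <-].
exists x, s, y, t; do !split => //.
- by move: sT; rewrite in_itv/= -ler_norml.
- by move: tT; rewrite in_itv/= -ler_norml.
Qed.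

Lemma nbhs_osc T delta eps r x y t : `|t| < T -> 0 < delta ->
  (x < r%:E)%E -> ((r + eps)%:E < y)%E ->
  nbhs ((SqzPt x t, SqzPt y t) : sqzS d * sqzS d) (osc T delta eps r).
Proof.
move=> tT delta0 xr ry.
pose e := Num.min (delta / 2) (T - `|t|).
have e0 : 0 < e by rewrite lt_min divr_gt0//= subr_gt0.
pose W (N : set (\bar R)) : set (sqzS d) :=
  [set z | exists v' t', [/\ z = SqzPt v' t', N v' & `|t - t'| < e]].
have nbhsW (v : \bar R) N : nbhs v N -> nbhs (SqzPt v t : sqzS d) (W N).
  move=> vN.
  have NN : nbhs (SqzPt v t : sqzS d) (@sqz_space R @^-1` N).
    exact: (@sqz_space_cvg R d v t N vN).
  have tN : nbhs t%:E (EFin @` [set t' | `|t - t'| < e]).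
    have : \forall t' \near t, `|t - t'| < e by exact: nbhsx_ballx.
    by apply: (@filterS _ (nbhs t)) => t' H; exists t'.
  have := @sqz_time_continuous R d (SqzPt v t) _ tN.
  move: NN; apply: (@filterS2 _ (nbhs (SqzPt v t : sqzS d))) => z /= Nz.
  move=> [t' tt' zt'].
  case: z Nz zt' => [v' s||] //= Nv' [st']; exists v', s; split => //.
  by rewrite -st'.
exists (W [set x' | (x' < r%:E)%E], W [set y' | ((r + eps)%:E < y')%E]).
  split; apply: nbhsW; apply: open_nbhs_nbhs; split => //.
    exact: open_ereal_lt_ereal.
  exact: open_ereal_gt_ereal.
move=> [z w] [/= [x' [s [-> xr' ts]]] [y' [s' [-> yr' ts']]]].
exists x', s, y', s'; split; last by split; exact: ltW.
have e1 : e <= delta / 2 by rewrite ge_min lexx.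
have e2 : e <= T - `|t| by rewrite ge_min lexx orbT.
have near_le u : `|t - u| < e -> `|u| <= T.
  move=> tu; rewrite (_ : u = t - (t - u)); last by ring.
  by have := ler_normB t (t - u); lra.
split => //; [exact: near_le|exact: near_le|].
rewrite (_ : s - s' = (t - s') - (t - s)); last by ring.
by have := ler_normB (t - s') (t - s); lra.
Qed.

Lemma ereal_gap (x y : \bar R) : (x < y)%E -> exists (q : rat) (k : nat),
  (x < (ratr q : R)%:E)%E /\ ((ratr q + k.+1%:R^-1 : R)%:E < y)%E.
Proof.
move=> xy.
have [a [b [xa ab bY]]] : exists a b : R,
    [/\ (x < a%:E)%E, a < b & (b%:E < y)%E].
  case: x y xy => [x||] [y||] //; rewrite ?lte_fin => xy.
  - exists (x + (y - x) / 3), (x + 2 * (y - x) / 3).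
    by rewrite !lte_fin; split; lra.
  - by exists (x + 1), (x + 2); rewrite !lte_fin; split; [lra|lra|exact: ltry].
  - by exists (y - 2), (y - 1); rewrite !lte_fin; split; [exact: ltNyr|lra|lra].
  - by exists 0, 1; split; [exact: ltNyr|lra|exact: ltry].
(* The rational lies in the left half of (a, b), which leaves room for a gap of
   size (b - a) / 2 above it. *)
have [q] := @rat_in_itvoo R a ((a + b) / 2) ltac:(lra).
rewrite in_itv/= => /andP[aq qb].
have ba : 0 < (b - a) / 2 by lra.
near \oo => k.
have kk : k.+1%:R^-1 < (b - a) / 2.
  by near: k; exact: (near_infty_natSinv_lt (PosNum ba)).
exists q, k; split; first by apply: lt_trans xa _; rewrite lte_fin.
apply: lt_trans bY; rewrite lte_fin (lt_le_trans (ltrD qb kk))//.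
lra.
Unshelve. all: end_near. Qed.

(** For a fixed pair of graph points membership in [osc] fails for small delta:
    otherwise the times agree, hence the points, contradicting the gap eps.
    Closedness of [osc] spreads this to nearby pairs, compactness of the graph
    to all pairs, and [closed_hits] to nearby paths. *)
Lemma osc_small T eps r p : 0 < eps ->
  \forall q \near p & delta \near 0^'+, ~ hits q (osc T delta eps r).
Proof.
move=> eps0.
(* One good delta is good for nearby paths, and so is every smaller one. *)
suff [delta delta0 pB] :
    exists2 delta, 0 < delta & ~ hits p (osc T delta eps r).
  exists (~` [set q | hits q (osc T delta eps r)],
    [set delta' | delta' < delta]).
    split => /=; last exact: nbhs_right_lt.
    apply: open_nbhs_nbhs; split => //; apply: closed_openC.
    by apply: closed_hits; exact: closed_osc.
  move=> [q delta'] [/= qB dd'] [z [w [qz qw zw]]]; apply: qB.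
  by exists z, w; split => //; apply: le_osc zw; exact: ltW.
have cpp : compact (cgraph p `*` cgraph p).
  by apply: compact_setX; exact: cgraph_compact.
move/compact_near_coveringP : cpp => cov.
have : \forall delta \near 0^'+, cgraph p `*` cgraph p `<=`
    (fun zw => ~ osc T delta eps r zw).
  apply: (cov _ 0^'+ (fun delta zw => ~ osc T delta eps r zw)).
  move=> [z w] [/= pz pw].
  have [delta delta0 zwB] :
      exists2 delta, 0 < delta & ~ osc T delta eps r (z, w).
    apply: contrapT => /forall2NP H.
    have osc_zw delta : 0 < delta -> osc T delta eps r (z, w).
      by move=> delta0; have [|/contrapT] := H delta.
    have [x [s [y [t [[[zE wE] _ _ _] [xr ry]]]]]] := osc_zw 1 ltr01.
    have st : s = t.
      apply/eqP; rewrite -subr_eq0 -normr_le0 leNgt; apply/negP => st0.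
      have st2 : 0 < `|s - t| / 2 by rewrite divr_gt0.
      have [x' [s' [y' [t' [[[zE' wE'] _ _ std] _]]]]] := osc_zw _ st2.
      move: zE' wE' std; rewrite zE wE => -[_ <-] [_ <-]; lra.
    move: pz pw; rewrite zE wE st => /cgraph_pt[_ xE] /cgraph_pt[_ yE].
    have : (r%:E < (r + eps)%:E)%E by rewrite lte_fin ltrDl.
    by move=> /(le_lt_trans xr) /lt_le_trans /(_ ry); rewrite xE yE ltxx.
  exists (~` osc T delta eps r, [set delta' | delta' < delta]).
    split => /=; last exact: nbhs_right_lt.
    apply: open_nbhs_nbhs; split => //.
    by apply: closed_openC; exact: closed_osc.
  by move=> [zw' delta'] [/= nB dd'] B; apply: nB; apply: le_osc B; exact: ltW.
move=> H; near (0:R)^'+ => delta; exists delta => //.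
by move=> [z [w [pz pw]]]; apply: (near H delta _ (z, w)).
Unshelve. all: end_near. Qed.

End oscillation.

(** * Separation of continuous paths *)

Section path_separation.
Context (R : realType) (d : sqz_metric R).
Implicit Types (p q : cpath d).

Lemma jpath_eq (p q : jpath R) :
  edom p = edom q -> lval p = lval q -> rval p = rval q -> p = q.
Proof.
case: p => E l r ? ? ? ? ? ? ? ?; case: q => E' l' r' ? ? ? ? ? ? ? ? /=.
by move=> EE' ll' rr'; subst E' l' r'; congr JPath; exact: Prop_irrelevance.
Qed.

(** The values outside the domain are normalised to 0, so nothing but the graph
    is left to determine a path. *)
Lemma cgraph_injective : injective (@cgraph R d).
Proof.
move=> p q pq; apply/val_inj.
have E : edom (val p) = edom (val q).
  apply/seteqP; split => -[t||].
  - move=> pt; have : cgraph p (SqzPt (lval (val p) t) t) by apply/cgraph_pt.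
    by rewrite pq => /cgraph_pt[].
  - by change (cgraph p SqzPinfty -> cgraph q SqzPinfty); rewrite pq.
  - by change (cgraph p SqzNinfty -> cgraph q SqzNinfty); rewrite pq.
  - move=> qt; have : cgraph q (SqzPt (lval (val q) t) t) by apply/cgraph_pt.
    by rewrite -pq => /cgraph_pt[].
  - by change (cgraph q SqzPinfty -> cgraph p SqzPinfty); rewrite pq.
  - by change (cgraph q SqzNinfty -> cgraph p SqzNinfty); rewrite pq.
have D : dom (val p) = dom (val q) by rewrite /dom E.
have L : lval (val p) = lval (val q).
  apply/funext => t; have [pt|npt] := pselect (dom (val p) t).
    have : cgraph p (SqzPt (lval (val p) t) t) by apply/cgraph_pt.
    by rewrite pq => /cgraph_pt[].
  by rewrite (lval_out npt); rewrite D in npt; rewrite (lval_out npt).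
apply: jpath_eq => //; apply/funext => t.
have [pt|npt] := pselect (dom (val p) t).
  by rewrite -cpath_lrval// L cpath_lrval// -D.
by rewrite (rval_out npt); rewrite D in npt; rewrite (rval_out npt).
Qed.

Lemma cpath_hausdorff : hausdorff_space (cpath d).
Proof.
move=> p q pq.
have close_pq r : 0 < r -> hclose d r (cgraph p) (cgraph q).
  move=> r0; have r20 : 0 < r / 2 by rewrite divr_gt0.
  have nearp : nbhs p [set p' | hclose d (r / 2) (cgraph p) (cgraph p')].
    by apply/nbhs_cpathP; exists (r / 2).
  have nearq : nbhs q [set q' | hclose d (r / 2) (cgraph q) (cgraph q')].
    by apply/nbhs_cpathP; exists (r / 2).
  have [p' [pp' qp']] := pq _ _ nearp nearq.
  by rewrite (splitr r); apply: hclose_trans pp' (hclose_sym qp').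
have clg (p' : cpath d) : closed (cgraph p').
  by apply: compact_closed; [exact: metric_hausdorff|exact: cgraph_compact].
apply: cgraph_injective; apply/seteqP; split => z gz.
- apply: clg => N /nbhs_ballP[r /= r0 rN].
  have [w qw zw] := (close_pq _ r0).1 _ gz.
  by exists w; split => //; exact: rN.
- apply: clg => N /nbhs_ballP[r /= r0 rN].
  have [w qw zw] := (close_pq _ r0).2 _ gz.
  by exists w; split => //; apply: rN; rewrite sqz_ballE sqz_dist_sym.
Qed.

Lemma cdJ1_nbhs p (U : set (cpath d)) : nbhs p U ->
  exists2 r, 0 < r & \forall q \near p, forall q', (cdJ1 q q' < r%:E)%E -> U q'.
Proof.
move=> /nbhs_cpathP[r r0 rU]; have r20 : 0 < r / 2 by rewrite divr_gt0.
exists (r / 2) => //; apply/nbhs_cpathP; exists (r / 2) => // q pq q' qq'.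
by apply: rU; rewrite (splitr r); apply: hclose_trans pq (dJ1_hclose qq').
Qed.

Lemma near_cdJ1 p (e : R) : 0 < e ->
  exists2 N, nbhs p N & forall q q', N q -> N q' -> (cdJ1 q q' < e%:E)%E.
Proof.
move=> /(hclose_cdJ1 p)[r r0 H].
exists [set q | hclose d r (cgraph p) (cgraph q)].
  by apply/nbhs_cpathP; exists r.
by move=> q q'; exact: H.
Qed.

End path_separation.

(** * The hyperspace of nonempty compact sets *)

(** The distance [D] of X enters through two locally uniform forms of
    compatibility with the topology: small [D]-balls around nearby points stay
    in a given neighbourhood, and [D] is small on small neighbourhoods.  In this
    form they hold for the J1 distance of continuous paths, by [cdJ1_nbhs] and
    [near_cdJ1]. *)
Section hyperspace.
Context (R : realType) (X : topologicalType) (D : X -> X -> \bar R).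
Context (D_ball_sub : forall (x : X) U, nbhs x U ->
  exists2 r : R, 0 < r & \forall y \near x, forall z, (D y z < r%:E)%E -> U z).
Context (D_small : forall (x : X) (e : R), 0 < e ->
  exists2 N : set X, nbhs x N & forall y z, N y -> N z -> (D y z < e%:E)%E).
Context (hX : hausdorff_space X).
Implicit Types (K L : Kplus D) (U V : set X).

Let hausdorff_lt (A B : set X) (e : R) : (hausdorff_dist D A B < e%:E)%E ->
  (forall a, A a -> exists2 b, B b & (D a b < e%:E)%E) /\
  (forall b, B b -> exists2 a, A a & (D a b < e%:E)%E).
Proof.
rewrite /hausdorff_dist gt_max => /andP[AB BA]; split => x Cx.
  have : (ereal_inf [set D x b | b in B] < e%:E)%E.
    by apply: le_lt_trans AB; apply: ereal_sup_ubound; exists x.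
  by move=> /ereal_inf_lt[_ [b Bb <-] xb]; exists b.
have : (ereal_inf [set D a x | a in A] < e%:E)%E.
  by apply: le_lt_trans BA; apply: ereal_sup_ubound; exists x.
by move=> /ereal_inf_lt[_ [b Bb <-] xb]; exists b.
Qed.

Let hausdorff_le (A B : set X) (e : R) :
  (forall a, A a -> exists2 b, B b & (D a b < e%:E)%E) ->
  (forall b, B b -> exists2 a, A a & (D a b < e%:E)%E) ->
  (hausdorff_dist D A B <= e%:E)%E.
Proof.
move=> AB BA; rewrite /hausdorff_dist ge_max; apply/andP; split.
  apply: ge_ereal_sup => _ [a /AB[b Bb ab] <-].
  by apply: le_trans (ltW ab); apply: ereal_inf_lbound; exists b.
apply: ge_ereal_sup => _ [b /BA[a Aa ab] <-].
by apply: le_trans (ltW ab); apply: ereal_inf_lbound; exists a.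
Qed.

(** This lemma and the next say that the topology of the Hausdorff distance is
    finer than the Vietoris topology. *)
Lemma open_Kplus_meets U : open U -> open [set K : Kplus D | K `&` U !=set0].
Proof.
move=> oU; suff : dist_open (fun K L : Kplus D => hausdorff_dist D K L)
  [set K : Kplus D | K `&` U !=set0] by [].
move=> K [a [Ka Ua]].
have [r r0 /nbhs_singleton rU] := D_ball_sub (open_nbhs_nbhs (conj oU Ua)).
exists r => // L /hausdorff_lt[/(_ _ Ka)[b Lb ab] _].
by exists b; split => //; exact: rU.
Qed.

Lemma open_Kplus_sub U : open U -> open [set K : Kplus D | K `<=` U].
Proof.
move=> oU; suff : dist_open (fun K L : Kplus D => hausdorff_dist D K L)
  [set K : Kplus D | K `<=` U] by [].
move=> K KU.
have /compact_near_coveringP cov := @kset_compact _ _ _ K.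
have : \forall r \near (0:R)^'+, K `<=`
    (fun a => forall b, (D a b < r%:E)%E -> U b).
  apply: (cov _ (0:R)^'+ (fun r a => forall b, (D a b < r%:E)%E -> U b)).
  move=> a /KU Ua.
  have [r r0 rU] := D_ball_sub (open_nbhs_nbhs (conj oU Ua)).
  exists ([set y | forall z, (D y z < r%:E)%E -> U z], [set s | s < r]).
    by split => //=; exact: nbhs_right_lt.
  move=> [a' s] [/= a'U sr] b ab; apply: a'U; apply: lt_trans ab _.
  by rewrite lte_fin.
move=> H; near (0:R)^'+ => r; exists r => // L /hausdorff_lt[_ LK] b.
by move=> /LK[a Ka]; apply: (near H r).
Unshelve. all: end_near. Qed.

Let kset_inj K L : kset K = kset L -> K = L.
Proof.
case: K => K K0 cK; case: L => L L0 cL /= KL; subst L.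
by congr KPlus; exact: Prop_irrelevance.
Qed.

(** A point a of K' outside the compact L' has a neighbourhood N whose closure
    misses L'; then meeting the interior of N and avoiding its closure separate
    K' and L'. *)
Lemma Kplus_hausdorff : hausdorff_space (Kplus D).
Proof.
move=> K L KL.
suff sub (K' L' : Kplus D) : cluster (nbhs K') L' -> K' `<=` L'.
  apply: kset_inj; apply/seteqP; split; first exact: sub.
  by apply: sub => A B LA KB; rewrite setIC; exact: KL.
move=> K'L' a Ka; apply: contrapT => nLa.
have [N aN NL] : exists2 N, nbhs a N & L' `<=` ~` closure N.
  have /compact_near_coveringP cov := @kset_compact _ _ _ L'.
  have : \forall N \near powerset_filter_from (nbhs a),
      L' `<=` (fun x => ~ closure N x).
    apply: (cov _ (powerset_filter_from (nbhs a)) (fun N x => ~ closure N x)).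
    move=> x L'x; have : a != x by apply: contra_not_neq nLa => ->.
    move=> ax; move: hX; rewrite open_hausdorff => /(_ _ _ ax).
    move=> [[U V] /= [/set_mem Ua /set_mem Vx] [oU oV /eqP UV]].
    near=> x' N => clN.
    have Vx' : V x' by near: x'; exact: open_nbhs_nbhs.
    have NU : N `<=` U.
      by near: N; apply: small_set_sub; exact: open_nbhs_nbhs.
    have [y [Ny Vy]] := clN _ (open_nbhs_nbhs (conj oV Vx')).
    have : (U `&` V) y by split => //; exact: NU.
    by rewrite UV.
  move=> H; near (powerset_filter_from (nbhs a)) => N; exists N.
    by near: N; exact: near_small_set.
  exact: (near H N).
have NK : nbhs K' [set K0 : Kplus D | K0 `&` N° !=set0].
  apply: open_nbhs_nbhs; split; last by exists a.
  exact: (open_Kplus_meets (@open_interior _ _)).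
have NL' : nbhs L' [set K0 : Kplus D | K0 `<=` ~` closure N].
  apply: open_nbhs_nbhs; split => //; apply: open_Kplus_sub.
  by apply: closed_openC; exact: closed_closure.
have [K0 [[b [K0b /interior_subset Nb]] K0N]] := K'L' _ _ NK NL'.
by apply: (K0N _ K0b); exact: subset_closure.
Unshelve. all: end_near. Qed.

(** The hyperspace of a compact space is compact: an ultrafilter of compact
    subsets converges to its limit set. *)
Lemma compact_Kplus_sub Q : compact Q -> compact [set K : Kplus D | K `<=` Q].
Proof.
move=> cQ; have clQ := compact_closed hX cQ.
rewrite compact_ultra => F UF FQ.
have PF : ProperFilter F := ultra_proper.
pose k (K : Kplus D) : set X := K.
pose L := ultralim k F.
have LQ : L `<=` Q by exact: ultralim_subclosed.
have cL : compact L.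
  exact: subclosed_compact (@ultralim_closed _ _ _ _) cQ LQ.
have L0 : L !=set0.
  by apply: ultralim_nonempty cQ _ _ => // K; exact: kset_nonempty.
exists (KPlus D L0 cL); split => //.
move=> U; rewrite nbhsE => -[B [oB BL] BU].
have [e e0 eB] := oB _ BL.
have e20 : 0 < e / 2 by rewrite divr_gt0.
have FL : \forall K \near F, L `<=`
    (fun a => exists2 b, k K b & (D a b < (e / 2)%:E)%E).
  have /compact_near_coveringP cov := cL.
  apply: (cov _ F (fun K a => exists2 b, k K b & (D a b < (e / 2)%:E)%E)).
  move=> a La; have [N aN ND] := D_small a e20.
  exists (N, [set K | k K `&` N !=set0]); first by split => //; exact: La.
  by move=> [a' K] [/= Na' [b [Kb Nb]]]; exists b => //; exact: ND.
pose V := (\bigcup_(a in L) [set b | (D a b < (e / 2)%:E)%E])°.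
have LV : L `<=` V.
  move=> a La; have [N aN ND] := D_small a e20.
  have Na := nbhs_singleton aN.
  by apply: filterS aN => b Nb; exists a => //; exact: ND.
have FV : \forall K \near F, k K `<=` V.
  by apply: ultralim_near_open cQ _ _ LV => //; exact: open_interior.
apply: filterS2 FL FV => K LK KV; apply: BU; apply: eB.
apply: (@le_lt_trans _ _ (e / 2)%:E); last by rewrite lte_fin; lra.
by apply: hausdorff_le => // b /KV /interior_subset[a La ab]; exists a.
Qed.

End hyperspace.

(** * Tightness *)

Section oscillating_sets.
Context (R : realType) (d : sqz_metric R).
Notation KX := (Kplus (@cdJ1 R d)).
Implicit Types (K : KX) (T delta eps r : R).

Definition oscillating T delta eps r : set (borel KX) :=
  [set K : KX | exists2 p, kset K p & hits p (osc T delta eps r)].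

Lemma S2_oscillating T delta eps r K : 0 < eps ->
  (S2 T delta eps r `&` (val @` (K : set (cpath d))) !=set0) <->
  oscillating T delta eps r K.
Proof.
move=> eps0; split=> [[p0 [pS [p Kp pE]]]|[p Kp /(S2_hits _ _ _ _ eps0) pS]].
  by exists p => //; apply/(S2_hits _ _ _ _ eps0); rewrite pE.
by exists (val p); split => //; exists p.
Qed.

Let open_nonoscillating T delta eps r :
  open (~` oscillating T delta eps r : set KX).
Proof.
rewrite (_ : ~` _ =
  [set K : KX | K `<=` ~` [set p | hits p (osc T delta eps r)]]).
  apply: open_Kplus_sub; first exact: (@cdJ1_nbhs R d).
  by apply: closed_openC; apply: closed_hits; exact: closed_osc.
apply/seteqP; split => K.
  by move=> nK p Kp pB; apply: nK; exists p.
by move=> KB [p Kp pB]; exact: (KB p).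
Qed.

Lemma measurable_open (Y : ptopologicalType) (U : set Y) :
  open U -> measurable (U : set (borel Y)).
Proof. by move=> oU; exact: sub_sigma_algebra. Qed.

Lemma measurable_oscillating T delta eps r :
  measurable (oscillating T delta eps r).
Proof.
rewrite -(setCK (oscillating _ _ _ _)); apply: measurableC.
exact: (@measurable_open KX _ (@open_nonoscillating T delta eps r)).
Qed.

Let cdJ1_Kplus_hausdorff : hausdorff_space KX.
Proof.
by apply: Kplus_hausdorff; [exact: cdJ1_nbhs|exact: cpath_hausdorff].
Qed.

(** Compact sets are closed, hence Borel, in a Hausdorff hyperspace.  Without
    measurability the inclusions of events below would give no inequalities. *)
Lemma measurable_compactC (C : set KX) : compact C ->
  measurable (~` C : set (borel KX)).
Proof.
move=> cC; apply: measurable_open; apply: closed_openC.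
exact: compact_closed.
Qed.

(** Two successive compactness arguments make [osc_small] uniform: over the
    paths in one compact set, then over the compact family of such sets. *)
Lemma compact_nonoscillating T eps r (C : set KX) : 0 < eps -> compact C ->
  \forall delta \near 0^'+, oscillating T delta eps r `<=` ~` C.
Proof.
move=> eps0 /compact_near_coveringP cov.
have osc_le delta delta' K : delta <= delta' ->
    oscillating T delta eps r K -> oscillating T delta' eps r K.
  move=> dd' [p Kp [z [w [pz pw zw]]]]; exists p => //.
  exists z, w; split => //.
  exact: le_osc zw.
have H : \forall delta \near 0^'+,
    C `<=` (fun K => ~ oscillating T delta eps r K).
  apply: (cov _ 0^'+ (fun delta K => ~ oscillating T delta eps r K)) => K _.
  have /compact_near_coveringP covK := @kset_compact _ _ _ K.
  have HK : \forall delta \near 0^'+, K `<=`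
      (fun p => ~ hits p (osc T delta eps r)).
    apply: (covK _ 0^'+ (fun delta p => ~ hits p (osc T delta eps r))) => p _.
    exact: osc_small.
  near (0:R)^'+ => delta.
  have nK : ~ oscillating T delta eps r K.
    by move=> [p Kp]; exact: (near HK delta).
  exists (~` oscillating T delta eps r, [set delta' | delta' < delta]).
    split => /=; last exact: nbhs_right_lt.
    by apply: (@open_nbhs_nbhs KX); split => //; exact: open_nonoscillating.
  move=> [K' delta'] [/= nK' dd'] B; apply: nK'; apply: osc_le B.
  exact: ltW.
by apply: filterS H => delta H K KB CK; exact: (H K).
Unshelve. all: end_near. Qed.

(** The converse: one delta for each of countably many parameters that separate
    any two values is enough to confine paths to a compact set. *)
Lemma exists_compact_nonoscillating (T eps r delta : nat -> R) :
  (forall (x y : \bar R) (t : R), (x < y)%E -> exists n,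
    [/\ `|t| < T n, (x < (r n)%:E)%E & ((r n + eps n)%:E < y)%E]) ->
  (forall n, 0 < delta n) ->
  exists2 C : set KX, compact C &
    ~` C `<=` \bigcup_n oscillating (T n) (delta n) (eps n) (r n).
Proof.
move=> xyn delta0.
pose B n : set (sqzS d * sqzS d) := osc (T n) (delta n) (eps n) (r n).
exists [set K : KX | K `<=` [set p | forall n, ~ hits p (B n)°]].
  apply: compact_Kplus_sub; first exact: near_cdJ1.
    exact: cpath_hausdorff.
  apply: compact_avoid => x y t /xyn - /(_ t)[n [tn xn ny]].
  by exists n; exact: nbhs_osc.
move=> K /existsNP[p /not_implyP[Kp /existsNP[n /contrapT]]].
move=> [z [w [pz pw /interior_subset zw]]].
by exists n => //; exists p => //; exists z, w.
Qed.

End oscillating_sets.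

(* The supremum over Gamma is that of real numbers in [0, 1]; it is 0 if Gamma
   is empty. *)
Theorem theorem1p2 (R : realType) (d : sqz_metric R) (Gamma : Type)
    (disp : Gamma -> measure_display)
    (Omega : forall g : Gamma, measurableType (disp g))
    (P : forall g : Gamma, probability (Omega g) R)
    (A : forall g : Gamma, {RV (P g) >-> borel (Kplus (@cdJ1 R d))}) :
  tight (fun g => distribution (P g) (A g)) <->
  (forall T eps r : R, 0 < T -> 0 < eps ->
     sup (range (fun g => fine (P g
       [set w | S2 T delta eps r `&` (val @` (A g w : Kplus (@cdJ1 R d)))
                !=set0])))
     @[delta --> 0^'+] --> (0 : R)).
Proof.
have eventE T delta eps r g : 0 < eps ->
    [set w | S2 T delta eps r `&` (val @` (A g w : Kplus (@cdJ1 R d))) !=set0] =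
    A g @^-1` oscillating T delta eps r.
  by move=> eps0; apply/seteqP; split=> w /(S2_oscillating _ _ _ _ eps0).
have mA g (B : set (borel (Kplus (@cdJ1 R d)))) :
    measurable B -> measurable (A g @^-1` B).
  by move=> mB; rewrite -[_ @^-1` _]setTI; exact: measurable_funPT.
have mosc g T delta eps r := mA g _ (@measurable_oscillating R d T delta eps r).
have P01 g (B : set (Omega g)) : measurable B -> 0 <= fine (P g B) <= 1.
  move=> mB; rewrite fine_ge0//= -lee_fin fineK ?probability_le1//.
  exact: fin_num_measure.
have has_ub T delta eps r : 0 < eps -> has_ubound (range (fun g => fine (P g
    [set w | S2 T delta eps r `&` (val @` (A g w : Kplus (@cdJ1 R d)))
                !=set0]))).
  move=> eps0; exists 1 => _ [g _ <-]; rewrite eventE//.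
  by have /andP[] := P01 g _ (mosc g T delta eps r).
split=> [tightA T eps r T0 eps0|limA e e0].
  apply/cvgrPdist_le => e e0.
  have [C [cC Ce]] := tightA e e0.
  have oscC := @compact_nonoscillating R d T eps r C eps0 cC.
  near=> delta.
  (* The supremum of the empty set of reals is 0 by convention. *)
  have [[g0]|nG] := pselect (inhabited Gamma); last first.
    rewrite [X in sup X](_ : _ = set0) ?sup0 ?subrr ?normr0 ?ltW//.
    by rewrite -subset0 => x [g _ _]; apply: nG.
  rewrite sub0r normrN ger0_norm.
    apply: ge_sup; first by eexists; exists g0.
    move=> _ [g _ <-]; rewrite eventE//.
    rewrite -lee_fin fineK; last exact: fin_num_measure.
    apply: le_trans Ce; apply: (@le_trans _ _ (P g (A g @^-1` (~` C)))).
      apply: le_measure; rewrite ?inE.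
      - exact: mosc.
      - by apply: mA; exact: measurable_compactC.
      - by apply: preimage_subset; exact: (near oscC delta).
    by apply: ereal_sup_ubound; exists g.
  apply: (@le_trans _ _ (fine (P g0 (A g0 @^-1` oscillating T delta eps r)))).
    by have /andP[] := P01 g0 _ (mosc g0 T delta eps r).
  apply: sup_ubound; first exact: has_ub.
  by exists g0 => //; rewrite eventE.
(* The parameters are T = m + 1, eps = 1 / (k + 1) and a rational r; the triples
   (m, k, r) are enumerated by [unpickle], and numbers that code no triple stand
   for (0, 0, 0). *)
pose param n : nat * nat * rat := odflt (0%N, 0%N, 0) (unpickle n).
pose T n : R := (param n).1.1.+1%:R.
pose eps n : R := (param n).1.2.+1%:R^-1.
pose r n : R := ratr (param n).2.
have eps0 n : 0 < eps n by rewrite invr_gt0.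
have /choice[delta deltaP] : forall n, exists delta, 0 < delta /\ forall g,
    (P g (A g @^-1` oscillating (T n) delta (eps n) (r n)) <=
      (e / (2 ^ n.+1)%:R)%:E)%E.
  move=> n; have en : 0 < e / (2 ^ n.+1)%:R :> R.
    by rewrite divr_gt0// ltr0n expn_gt0.
  have := limA (T n) (eps n) (r n) (ltr0Sn _ _) (eps0 n).
  move=> /cvgrPdist_le/(_ _ en) H.
  have := @filterI _ _ (at_right_proper_filter 0) _ _ H (nbhs_right_gt 0).
  move=> /filter_ex[delta [+ delta0]].
  rewrite sub0r normrN => sup_le; exists delta; split => // g.
  rewrite -(@fineK _ (P g _)); last exact: fin_num_measure.
  rewrite lee_fin -eventE//; apply: le_trans (le_trans (ler_norm _) sup_le).
  by apply: sup_ubound; [exact: has_ub|exists g].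
have delta0 n : 0 < delta n by have [] := deltaP n.
have params (x y : \bar R) (t : R) : (x < y)%E -> exists n,
    [/\ `|t| < T n, (x < (r n)%:E)%E & ((r n + eps n)%:E < y)%E].
  move=> /(@ereal_gap R)[q [k [xq qy]]].
  near \oo => m; exists (pickle (m, k, q)).
  rewrite /T /eps /r /param pickleK/=; split => //.
  apply: (@lt_trans _ _ m%:R); last by rewrite ltr_nat.
  by near: m; exact: nbhs_infty_gtr.
have [C cC Cosc] := @exists_compact_nonoscillating R d _ _ _ _ params delta0.
exists C; split => //; apply: ge_ereal_sup => _ [g _ <-].
apply: le_trans (epsilon_trick0 xpredT (ltW e0)).
apply: (@le_trans _ _ (\sum_(0 <= n <oo)
    P g (A g @^-1` oscillating (T n) (delta n) (eps n) (r n)))%E).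
  apply: (@measure_sigma_subadditive _ _ _ (P g) (A g @^-1` (~` C))).
  - by move=> n; exact: mosc.
  - by apply: mA; exact: measurable_compactC.
  - by rewrite -preimage_bigcup; exact: preimage_subset.
apply: lee_nneseries => // n _; by have [_] := deltaP n; exact.
Unshelve. all: end_near. Qed.
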